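(* Let $k$ be a non-archimedean local field with ring of integers $\mathcal O_k$, uniformizing parameter $\pi$, and residue field of cardinality $p$. Let $\mathfrak E\subseteq\mathbb M_2(k)$ be an Eichler order of level $r\ge 0$, and let $\mathfrak H$ be the rank-$2$ order generated by a nonzero nilpotent element, i.e. $\mathfrak H=\mathcal O_k[c]$ with $c\neq0$, $c^2=0$. Let $e_1,e_2,e_3,e_4$ be the embedding numbers of $\mathfrak H$ into $\mathfrak E$ (defined in the context). Then $$e_4=\left[\frac{r+2}{2}\right],\qquad e_3=r+1,\qquad e_1=p^{[r/2]}+p^{[(r-1)/2]},$$ except that $e_1=1$ when $r=0$. Furthermore, $e_2=p^{[r/2]}$ if $r$ is even and $2\equiv0\pmod{\pi^{r/2}}$, while $e_2=e_1/2$ otherwise.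
   Context: $[x]$ denotes the largest integer not exceeding $x$. An Eichler order in $\mathbb M_2(k)$ is an intersection $\mathfrak E=\mathfrak D_1\cap\mathfrak D_2$ of two maximal orders; it has level $r\in\mathbb Z_{\ge0}$ if $\mathfrak D_1/\mathfrak E\cong\mathfrak D_2/\mathfrak E\cong\mathcal O_k/\pi^r\mathcal O_k$ as $\mathcal O_k$-modules. For an order $\mathfrak H$ spanning the $k$-algebra $L=k\mathfrak H$, an optimal embedding $\mathfrak H\to\mathfrak E$ is a homomorphism induced by a $k$-algebra embedding $\phi:L\to\mathbb M_2(k)$ with $\phi^{-1}(\mathfrak E)=\mathfrak H$. A suborder $\mathfrak H'\subseteq\mathfrak E$ is optimal if $k\mathfrak H'\cap\mathfrak E=\mathfrak H'$. Let $X$ be the set of optimal embeddings $\mathfrak H\to\mathfrak E$, and let $Y$ be the set of optimal suborders of $\mathfrak E$ isomorphic to $\mathfrak H$. Let $\Gamma_1=k^*\mathfrak E^*$ and let $\Gamma_2=\{g\in\mathrm{GL}_2(k): g\mathfrak E g^{-1}=\mathfrak E\}$; both act by conjugation on $X$ and $Y$. The embedding numbers are $$e_1=|X/\Gamma_1|,\quad e_2=|X/\Gamma_2|,\quad e_3=|Y/\Gamma_1|,\quad e_4=|Y/\Gamma_2|.$$ *)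

(* Defs.v *)
From HB Require Import structures.
From mathcomp Require Export all_boot all_order all_algebra.
From mathcomp Require Export all_classical.
Set Implicit Arguments.
Unset Strict Implicit.
Unset Printing Implicit Defensive.
Import Order.TTheory GRing.Theory Num.Theory.
#[export] Set Implicit Arguments.
#[export] Unset Strict Implicit.
#[export] Unset Printing Implicit Defensive.
Export Order.TTheory GRing.Theory Num.Theory.
Local Open Scope classical_set_scope.
Local Open Scope ring_scope.

(* The value of a valuation [v : k -> int] at 0 is irrelevant (it stands for
   +oo), so 0 is always treated separately. *)
Section LocalField.
Variables (k : fieldType) (v : k -> int).

Definition val_ge (n : int) : set k := [set x | x = 0 \/ n <= v x].

Definition discrete_valuation : Prop :=
  [/\ forall x y : k, x != 0 -> y != 0 -> v (x * y) = v x + v y,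
      forall x y : k, x != 0 -> y != 0 -> x + y != 0 ->
        Num.min (v x) (v y) <= v (x + y)
    & forall n : int, exists2 x : k, x != 0 & v x = n].

Definition val_cauchy (u : nat -> k) : Prop :=
  forall n : int, exists N : nat, forall i j : nat,
    (N <= i)%N -> (N <= j)%N -> val_ge n (u i - u j).

Definition val_converges (u : nat -> k) (l : k) : Prop :=
  forall n : int, exists N : nat, forall i : nat,
    (N <= i)%N -> val_ge n (u i - l).

Definition integers : set k := val_ge 0.

Definition uniformizer (pi : k) : Prop := pi != 0 /\ v pi = 1.

(* The residue field as the set of cosets in [integers] of the maximal ideal. *)
Definition residue_field : set (set k) :=
  [set [set y | val_ge 1 (y - x)] | x in integers].

Definition local_field : Prop :=
  [/\ discrete_valuation,
      forall u, val_cauchy u -> exists l, val_converges u l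
    & finite_set residue_field].

Definition uniformizer_ideal (pi : k) (n : nat) : set k :=
  [set pi ^+ n * x | x in integers].

End LocalField.

Definition span_over (k : fieldType) (V : lmodType k) (C : set k) (S : set V) :
    set V :=
  [set x | exists (n : nat) (a : 'I_n -> k) (s : 'I_n -> V),
     [/\ forall i, C (a i), forall i, S (s i) & x = \sum_i a i *: s i]].

(* M/N and M'/N' are isomorphic modules over O, for O-submodules N of M and
   N' of M'. The map f gives a representative f x of the image of the class of
   x; the four conditions say that the induced map M/N -> M'/N' makes sense and
   is O-linear, well defined and injective, and surjective. *)
Definition quotient_isomorphic (k : fieldType) (V V' : lmodType k) (O : set k)
    (M N : set V) (M' N' : set V') : Prop :=
  exists f : V -> V',
    [/\ forall x, M x -> M' (f x),
        forall a x y, O a -> M x -> M y ->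
          N' (f (a *: x + y) - (a *: f x + f y)),
        forall x, M x -> (N' (f x) <-> N x)
      & forall y, M' y -> exists2 x, M x & N' (y - f x)].

Section Orders.
Variables (k : fieldType) (v : k -> int).
Local Notation O := (integers v).

(* An order in the k-algebra spanned by R, which need not be all of A. *)
Definition is_order (A : algType k) (R : set A) : Prop :=
  [/\ R 1,
      forall x y, R x -> R y -> R (x * y)
    & exists (n : nat) (s : 'I_n -> A), R = span_over O (range s)].

Definition full_order (A : algType k) (R : set A) : Prop :=
  is_order R /\ span_over setT R = setT.

Definition maximal_order (A : algType k) (R : set A) : Prop :=
  full_order R /\ forall R' : set A, full_order R' -> R `<=` R' -> R' = R.

(* Isomorphism of O_k-algebras between orders; the values of f outside of R
   are irrelevant. *)
Definition order_isomorphic (A B : algType k) (R : set A) (S : set B) : Prop :=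
  exists f : A -> B,
    [/\ set_bij R S f,
        forall a x y, O a -> R x -> R y -> f (a *: x + y) = a *: f x + f y,
        f 1 = 1
      & forall x y, R x -> R y -> f (x * y) = f x * f y].

Definition eichler_order (pi : k) (r : nat) (E : set 'M[k]_2) : Prop :=
  exists D1 D2 : set 'M[k]_2,
    [/\ maximal_order D1,
        maximal_order D2,
        E = D1 `&` D2,
        quotient_isomorphic O D1 E (O : set k^o) (uniformizer_ideal v pi r)
      & quotient_isomorphic O D2 E (O : set k^o) (uniformizer_ideal v pi r)].

Definition adjoin_integers (A : algType k) (c : A) : set A :=
  [set horner_alg c q | q in [set q : {poly k} | forall i, O q`_i]].

(* An optimal embedding of H is represented by the k-algebra embedding of the
   ambient algebra L inducing it; when H spans L, this map is determined by its
   restriction to H. *)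
Definition optimal_embeddings (L : algType k) (H : set L) (E : set 'M[k]_2) :
    set (L -> 'M[k]_2) :=
  [set (phi : L -> 'M[k]_2) | phi in
    [set phi : {lrmorphism L -> 'M[k]_2} |
       injective phi /\ phi @^-1` E = H]].

Definition optimal_suborders (L : algType k) (H : set L) (E : set 'M[k]_2) :
    set (set 'M[k]_2) :=
  [set S | [/\ is_order S, S `<=` E, span_over setT S `&` E = S
             & order_isomorphic H S]].

End Orders.

Section Conjugation.
Variable k : fieldType.

Definition conj_by (g x : 'M[k]_2) : 'M[k]_2 := g * x * g^-1.

Definition unit_group (E : set 'M[k]_2) : set 'M[k]_2 :=
  [set u | E u /\ exists u', [/\ E u', u * u' = 1 & u' * u = 1]].

Definition scalar_units (E : set 'M[k]_2) : set 'M[k]_2 :=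
  [set g | exists (a : k) (u : 'M[k]_2),
     [/\ a != 0, unit_group E u & g = a *: u]].

Definition order_normalizer (E : set 'M[k]_2) : set 'M[k]_2 :=
  [set g | g \is a GRing.unit /\ conj_by g @` E = E].

(* The quotients of a set of maps into, resp. of subsets of, M_2(k) by the
   conjugation action of Gamma, as sets of orbits. *)
Definition embedding_orbits (L : Type) (X : set (L -> 'M[k]_2))
    (Gamma : set 'M[k]_2) : set (set (L -> 'M[k]_2)) :=
  [set [set conj_by g \o phi | g in Gamma] | phi in X].

Definition suborder_orbits (Y : set (set 'M[k]_2)) (Gamma : set 'M[k]_2) :
    set (set (set 'M[k]_2)) :=
  [set [set conj_by g @` S | g in Gamma] | S in Y].

End Conjugation.

(* Main.v *)
From HB Require Import structures.
Require Import Defs.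
From mathcomp Require Import all_boot all_order all_algebra all_classical.
From mathcomp Require Import zify ring.
Local Open Scope classical_set_scope.
Local Open Scope card_scope.
Local Open Scope ring_scope.

(** A full order stabilises a lattice, so a maximal order is a conjugate of
    M_2(O); by the Smith form an Eichler order of level r is then a conjugate of
    E0 = [O, O; pi^r O, O].  An optimal embedding is determined by the image n
    of c, a nilpotent matrix [x, y; pi^r z, -x] with x^2 + pi^r y z = 0, x, y, z
    in O and y or z a unit; an optimal suborder determines n up to a unit of O.
    For r > 0 the class of n under Gamma_1 is determined by x modulo pi^r and
    by whether y is a unit.  If y is a unit then x is any element of
    pi^[(r+1)/2] O, otherwise any element of pi^([r/2]+1) O, whence e_1; up to
    units of O only min(v(x), r) matters instead of x, whence e_3.  The group
    Gamma_2 is generated by Gamma_1 and w = [0, 1; pi^r, 0], which maps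
    (x, y, z) to (-x, z, y).  It fixes a class only if y and z are both units
    and 2x = 0 modulo pi^r; in that case 2v(x) = r, so that r is even and pi^(r/2)
    divides 2.  Otherwise w acts freely on the classes and e_2 = e_1/2. *)

(** * Valuations and residues *)

(** The cardinals come from complete invariants: for r > 0 each relation on nilpotent matrices gets
    a code with values exactly 0, ..., e - 1, computed from x and y or, when w acts freely, derived
    from the code for Gamma_1. The exponents in e_1 are lengths: x runs over pi^a O / pi^r O with a
    = r - [r/2] if y is a unit and a = [r/2] + 1 otherwise, and r - a is the exponent of p. The two
    families differ in size only for even r, where y and z can both be units. If moreover 2 = 0
    modulo pi^(r/2), then w fixes every class with y and z units and pairs off the others, one with
    y a unit against one with z a unit; so each class under Gamma_2 contains exactly one class under
    Gamma_1 with y a unit, which gives p^[r/2] instead of half of e_1. Level 0 stands apart: w then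
    lies in Gamma_1, whether y is a unit is no longer an invariant, and there is a single class. *)

Section Valuation.
Variables (k : fieldType) (v : k -> int).
Hypothesis hv : discrete_valuation v.

Lemma valuationM x y : x != 0 -> y != 0 -> v (x * y) = v x + v y.
Proof. by case: hv => h _ _; apply: h. Qed.

Lemma valuation1 : v 1 = 0.
Proof.
have : v (1 * 1) = v 1 + v 1 by apply: valuationM; exact: oner_neq0.
by rewrite mulr1; lia.
Qed.

Lemma valuationN x : v (- x) = v x.
Proof.
have [->|x0] := eqVneq x 0; first by rewrite oppr0.
have n1 : (-1 : k) != 0 by rewrite oppr_eq0 oner_neq0.
have := valuationM n1 n1; rewrite mulrNN mulr1 valuation1 => h.
by rewrite -mulN1r valuationM //; lia.
Qed.

Lemma valuationV x : x != 0 -> v x^-1 = - v x.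
Proof.
move=> x0; have xi0 : x^-1 != 0 by rewrite invr_eq0.
by have := valuationM x0 xi0; rewrite divff // valuation1; lia.
Qed.

Lemma valuationX x n : x != 0 -> v (x ^+ n) = n%:Z * v x.
Proof.
move=> x0; elim: n => [|n IH]; first by rewrite expr0 valuation1; lia.
by rewrite exprS valuationM ?expf_neq0 // IH; lia.
Qed.

Lemma val_ge0 n : val_ge v n 0. Proof. by left. Qed.

Lemma val_geE n x : x != 0 -> val_ge v n x = (n <= v x).
Proof.
move=> x0; apply/propext.
by split=> [[xE|//]|]; [rewrite xE eqxx in x0|right].
Qed.

Lemma val_geW m n x : val_ge v n x -> m <= n -> val_ge v m x.
Proof. by move=> [->|h] mn; [left|right; lia]. Qed.

Lemma val_geN n x : val_ge v n (- x) = val_ge v n x.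
Proof.
apply/propext.
rewrite /val_ge/= valuationN; split=> -[h|h]; [left|by right|left|by right].
- by apply/eqP; rewrite -oppr_eq0 h.
- by rewrite h oppr0.
Qed.

Lemma val_geD n x y : val_ge v n x -> val_ge v n y -> val_ge v n (x + y).
Proof.
have [->|x0] := eqVneq x 0; first by rewrite add0r.
have [->|y0] := eqVneq y 0; first by rewrite addr0.
have [->|xy0] := eqVneq (x + y) 0; first by left.
case: hv => _ h _; rewrite !val_geE // => hx hy.
have := h _ _ x0 y0 xy0; lia.
Qed.

Lemma val_geB n x y : val_ge v n x -> val_ge v n y -> val_ge v n (x - y).
Proof. by move=> hx hy; apply: val_geD => //; rewrite val_geN. Qed.

Lemma val_geM m n x y :
  val_ge v m x -> val_ge v n y -> val_ge v (m + n) (x * y).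
Proof.
have [->|x0] := eqVneq x 0; first by rewrite mul0r; left.
have [->|y0] := eqVneq y 0; first by rewrite mulr0; left.
by rewrite !val_geE ?mulf_neq0 // valuationM //; lia.
Qed.

Lemma val_geZ n a x : a != 0 -> val_ge v n (a * x) = val_ge v (n - v a) x.
Proof.
move=> a0; have [->|x0] := eqVneq x 0; first by rewrite mulr0; apply/propext; split; left.
by rewrite !val_geE ?mulf_neq0 // valuationM // lerBlDl.
Qed.

Lemma val_geMl n x y : val_ge v 0 x -> val_ge v n y -> val_ge v n (x * y).
Proof. by move=> hx hy; rewrite -[n]add0r; apply: val_geM. Qed.

Lemma val_geMr n x y : val_ge v n x -> val_ge v 0 y -> val_ge v n (x * y).
Proof. by move=> hx hy; rewrite mulrC; apply: val_geMl. Qed.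

(** Valuations are integers, so the half of n may be rounded up; hence the [n + 1]. The bounds on
    v(x) by halves of r all come from here. *)
Lemma val_ge_sqr m n x : val_ge v n (x * x) -> m + m <= n + 1 -> val_ge v m x.
Proof.
have [->|x0] := eqVneq x 0; first by move=> *; left.
by rewrite !val_geE ?mulf_neq0 // valuationM //; lia.
Qed.

Lemma val_ge_1 : val_ge v 0 1.
Proof. by right; rewrite valuation1. Qed.

Definition val_unit (x : k) : Prop := x != 0 /\ v x = 0.

Lemma val_unitE x : val_unit x <-> val_ge v 0 x /\ ~ val_ge v 1 x.
Proof.
rewrite /val_unit; have [->|x0] := eqVneq x 0.
  by split=> [[]//|[_ []]]; left.
by rewrite !val_geE //; split=> [[]|[]]; lia.
Qed.

Lemma val_unitM x y : val_unit x -> val_unit y -> val_unit (x * y).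
Proof. by move=> [x0 hx] [y0 hy]; split; [rewrite mulf_neq0|rewrite valuationM // hx hy]. Qed.

Lemma val_unitV x : val_unit x -> val_unit x^-1.
Proof. by move=> [x0 hx]; split; [rewrite invr_eq0|rewrite valuationV // hx]. Qed.

Lemma val_unit_ge x : val_unit x -> val_ge v 0 x.
Proof. by move/val_unitE => []. Qed.

Lemma val_unit1 : val_unit 1.
Proof. by split; [rewrite oner_neq0|rewrite valuation1]. Qed.

Lemma val_unitD_ge x y : val_unit x -> val_ge v 1 y -> val_unit (x + y).
Proof.
move=> /val_unitE [h0 h1] hy; apply/val_unitE; split.
  by apply: val_geD => //; apply: val_geW hy _.
by move=> h; apply: h1; have := val_geB h hy; rewrite addrK.
Qed.

Section Uniformizer.
Variable pi : k.
Hypothesis hpi : uniformizer v pi.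

Lemma unif_neq0 : pi != 0. Proof. by case: hpi. Qed.
Lemma val_unif : v pi = 1. Proof. by case: hpi. Qed.
Lemma unifX_neq0 n : pi ^+ n != 0. Proof. by rewrite expf_neq0 // unif_neq0. Qed.
Lemma val_unifX n : v (pi ^+ n) = n%:Z.
Proof. by rewrite valuationX ?unif_neq0 // val_unif; lia. Qed.
Lemma unifX_ge n : val_ge v n%:Z (pi ^+ n).
Proof. by right; rewrite val_unifX. Qed.

Lemma val_ge_div n m x : val_ge v n (x / pi ^+ m) = val_ge v (n + m%:Z) x.
Proof.
have h : (pi ^+ m)^-1 != 0 by rewrite invr_eq0 unifX_neq0.
rewrite mulrC val_geZ // valuationV ?unifX_neq0 // val_unifX.
by rewrite opprK.
Qed.

Lemma uniformizer_idealE n x : uniformizer_ideal v pi n x <-> val_ge v n%:Z x.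
Proof.
split=> [[y hy <-]|hx].
  by rewrite val_geZ ?unifX_neq0 // val_unifX subrr.
exists (x / pi ^+ n); last by rewrite mulrC divfK ?unifX_neq0.
by rewrite /integers val_ge_div add0r.
Qed.

(** * Numbering the residues modulo powers of the uniformizer *)

Section Digits.
Variable p : nat.
Hypothesis hp : residue_field v #= `I_p.

(** The bijection in [hp] composed with the coset map. Counting needs only a numbering of the
    cosets, so the residue field never receives a ring structure. *)
Lemma residue_code : exists2 d : k -> nat,
  (forall x y, val_ge v 0 x -> val_ge v 0 y -> d x = d y <-> val_ge v 1 (x - y)) &
  (forall x, val_ge v 0 x -> (d x < p)%N) /\
  (forall i, (i < p)%N -> exists2 x, val_ge v 0 x & d x = i).
Proof.
have /card_set_bijP [f [ff fi fs]] := hp.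
exists (fun x => f [set y | val_ge v 1 (y - x)]); last split.
- move=> x y hx hy; split.
    move/fi; rewrite !inE => /(_ _ _)/predeqP h.
    have /h : [set y0 | val_ge v 1 (y0 - x)] x by rewrite /= subrr; left.
    by apply; [exists x|exists y].
  move=> h; congr f; apply/seteqP; split=> z /= hz.
    by rewrite (_ : z - y = (z - x) + (x - y)); [apply: val_geD|ring].
  by rewrite (_ : z - x = (z - y) - (x - y)); [apply: val_geB|ring].
- by move=> x hx; apply: ff; exists x.
- move=> i hi; have [_ [x hx <-] <-] := fs i hi.
  by exists x.
Qed.

Lemma residue_card_gt0 : (0 < p)%N.
Proof. by have [d _ [h _]] := residue_code; have := h 0 (val_ge0 0); lia. Qed.

(* [d x] has as base [p] digits the codes of the first [m] digits of the
   expansion of [x] in powers of [pi]. *)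
Lemma integers_code m : exists2 d : k -> nat,
  (forall x y, val_ge v 0 x -> val_ge v 0 y ->
     d x = d y <-> val_ge v m%:Z (x - y)) &
  (forall x, val_ge v 0 x -> (d x < p ^ m)%N) /\
  (forall i, (i < p ^ m)%N -> exists2 x, val_ge v 0 x & d x = i).
Proof.
have p0 := residue_card_gt0.
elim: m => [|m [d dP [dlt dsurj]]].
  exists (fun=> 0%N); last split=> //.
    by move=> x y hx hy; split=> // _; apply: val_geB.
  by move=> i; rewrite expn0 ltnS leqn0 => /eqP ->; exists 0 => //; left.
have [e eP [elt esurj]] := residue_code.
(* [s] picks an integral representative of each digit; the value 0 beyond [p] only makes it
   total. *)
have /choice [s sP] : forall i, exists x, val_ge v 0 x /\ ((i < p)%N -> e x = i).
  move=> i; case: (ltnP i p) => hi; first by have [x] := esurj i hi; exists x.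
  by exists 0; split=> //; left.
have spl x : val_ge v 0 x -> val_ge v 0 ((x - s (e x)) / pi ^+ 1).
  move=> hx; have [h1 h2] := sP (e x).
  by rewrite val_ge_div add0r -eP // h2 // elt.
(* The residue [e x] is the lowest digit; the higher ones are those of (x - s (e x)) / pi. *)
exists (fun x => d ((x - s (e x)) / pi ^+ 1) * p + e x)%N; last split.
- move=> x y hx hy; split.
    move=> h.
    have hxy : e x = e y.
      by have := congr1 (modn^~ p) h; rewrite !modnMDl !modn_small ?elt.
    move: h; rewrite hxy => /addIn/eqP; rewrite eqn_pmul2r // => /eqP.
    rewrite dP; [|by rewrite -hxy; apply: spl|exact: spl].
    rewrite -mulrBl val_ge_div.
    by rewrite (_ : _ - _ - _ = x - y); [rewrite -PoszD addn1|ring].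
  move=> h.
  have hxy : e x = e y by rewrite eP //; apply: val_geW h _; lia.
  congr (_ * _ + _)%N => //; apply/dP; [exact: spl|exact: spl|].
  rewrite hxy -mulrBl val_ge_div.
  by rewrite (_ : _ - _ - _ = x - y); [rewrite -PoszD addn1|ring].
- move=> x hx; have := elt x hx; have := dlt _ (spl x hx); rewrite expnS; nia.
- move=> i hi.
  have [|y hy dy] := dsurj (i %/ p)%N; first by rewrite ltn_divLR // -expnSr.
  have [h1 h2] := sP (i %% p)%N; have {}h2 := h2 (ltn_pmod i p0).
  have hpy : val_ge v 1 (y * pi ^+ 1).
    rewrite -[X in val_ge v X]add0r; apply: val_geM => //.
    by right; rewrite val_unifX.
  have hx : val_ge v 0 (s (i %% p)%N + y * pi ^+ 1).
    by apply: val_geD => //; apply: val_geW hpy _.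
  exists (s (i %% p)%N + y * pi ^+ 1) => //.
  have -> : e (s (i %% p)%N + y * pi ^+ 1) = (i %% p)%N.
    by rewrite -{2}h2 eP // addrAC subrr add0r.
  rewrite [s _ + _]addrC addrK mulfK ?unifX_neq0 // dy.
  by rewrite -divn_eq.
Qed.

(** Division by pi^a identifies pi^a O / pi^(a+m) O with O / pi^m O. *)
Lemma ideal_code a m : exists2 d : k -> nat,
  (forall x y, val_ge v a%:Z x -> val_ge v a%:Z y ->
     d x = d y <-> val_ge v (a + m)%N%:Z (x - y)) &
  (forall x, val_ge v a%:Z x -> (d x < p ^ m)%N) /\
  (forall i, (i < p ^ m)%N -> exists2 x, val_ge v a%:Z x & d x = i).
Proof.
have [d dP [dlt dsurj]] := integers_code m.
have aux x : val_ge v a%:Z x -> val_ge v 0 (x / pi ^+ a).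
  by rewrite val_ge_div add0r.
exists (fun x => d (x / pi ^+ a)); last split.
- move=> x y /aux hx /aux hy; rewrite dP // -mulrBl val_ge_div.
  by rewrite -PoszD addnC.
- by move=> x /aux; apply: dlt.
- move=> i /dsurj [y hy <-]; exists (y * pi ^+ a); last by rewrite mulfK ?unifX_neq0.
  by rewrite mulrC val_geZ ?unifX_neq0 // val_unifX subrr.
Qed.

End Digits.

(* [v 0] is a junk value: as [v 0] stands for +oo, 0 gets the value [r]. *)
Definition trunc_val (r : nat) (x : k) : nat :=
  if x == 0 then r else minn r `|v x|%N.

Lemma trunc_val_le r x : (trunc_val r x <= r)%N.
Proof. by rewrite /trunc_val; case: ifP => // _; lia. Qed.

Lemma trunc_val_geP r m x : val_ge v 0 x -> (m <= r)%N ->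
  (m <= trunc_val r x)%N <-> val_ge v m%:Z x.
Proof.
rewrite /trunc_val; case: eqP => [-> _ mr|/eqP x0].
  by split=> // _; left.
by rewrite !val_geE //; lia.
Qed.

Lemma trunc_val_unif r i : (i <= r)%N -> trunc_val r (pi ^+ i) = i.
Proof. by move=> ir; rewrite /trunc_val (negPf (unifX_neq0 i)) val_unifX; lia. Qed.

(** The orbits of the units of O on O / pi^r O are the sets of elements of a given valuation below
    r, together with the class of 0. *)
Lemma trunc_val_eqP r x y : val_ge v 0 x -> val_ge v 0 y ->
  trunc_val r x = trunc_val r y <-> exists2 u, val_unit u & val_ge v r%:Z (x - u * y).
Proof.
move=> hx hy; split; last first.
  move=> [u hu h].
  have geE m : (m <= r)%N -> (m <= trunc_val r x)%N <-> (m <= trunc_val r y)%N.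
    move=> mr; rewrite !trunc_val_geP //.
    have {}h := val_geW h (_ : m%:Z <= r%:Z).
    split=> hm.
      have : val_ge v m%:Z (x - (x - u * y)) by apply: val_geB => //; apply: h; lia.
      rewrite opprB addrC subrK; case: hu => u0 uv.
      by rewrite val_geZ // uv subr0.
    rewrite -[x](subrK (u * y)); apply: val_geD; first by apply: h; lia.
    by apply: val_geMl => //; apply: val_unit_ge.
  apply/eqP; rewrite eqn_leq; apply/andP; split.
    by rewrite -geE ?trunc_val_le.
  by rewrite geE ?trunc_val_le.
have small z : val_ge v 0 z -> trunc_val r z = r -> val_ge v r%:Z z.
  by move=> hz hr; rewrite -(@trunc_val_geP r) ?hr.
(* At the bound r both x and y vanish modulo pi^r and u = 1 serves; below it both are nonzero of
   equal valuation and u = x / y. *)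
have [hr|hr] := eqVneq (trunc_val r y) r.
  rewrite hr => /small hx'; have {}hx' := hx' hx.
  exists 1; first exact: val_unit1.
  by rewrite mul1r; apply: val_geB => //; apply: small.
rewrite /trunc_val; move: hr; rewrite /trunc_val.
case: ifPn; first by rewrite eqxx.
move=> y0; case: ifPn => [|x0 hr h]; first by move=> *; lia.
exists (x / y); last by rewrite divfK // subrr; left.
split; first by rewrite mulf_neq0 ?invr_eq0.
move: hx hy; rewrite valuationM ?invr_eq0 // valuationV // !val_geE //; lia.
Qed.

End Uniformizer.
End Valuation.

(** * Two by two matrices *)

Section Matrices.
Variable k : fieldType.
Implicit Types (a b c d x y z : k) (g h m n : 'M[k]_2).

(** Explicit entries turn matrix identities into scalar ones within reach of [ring] and [field]. *)
Definition mx2 a b c d : 'M[k]_2 :=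
  \matrix_(i < 2, j < 2)
    if i == 0 then (if j == 0 then a else b) else (if j == 0 then c else d).

Lemma mx2_00 a b c d : mx2 a b c d 0 0 = a. Proof. by rewrite mxE. Qed.
Lemma mx2_01 a b c d : mx2 a b c d 0 1 = b. Proof. by rewrite mxE. Qed.
Lemma mx2_10 a b c d : mx2 a b c d 1 0 = c. Proof. by rewrite mxE. Qed.
Lemma mx2_11 a b c d : mx2 a b c d 1 1 = d. Proof. by rewrite mxE. Qed.
Definition mx2E := (mx2_00, mx2_01, mx2_10, mx2_11).

Lemma ord2P (i : 'I_2) : i = 0 \/ i = 1.
Proof. by case: i => [[|[|//]] hi]; [left|right]; apply/val_inj. Qed.

Lemma mx2_eta m : m = mx2 (m 0 0) (m 0 1) (m 1 0) (m 1 1).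
Proof.
by apply/matrixP => i j; case: (ord2P i) => ->; case: (ord2P j) => ->; rewrite mxE.
Qed.

Lemma mx2_inj a b c d a' b' c' d' :
  mx2 a b c d = mx2 a' b' c' d' -> [/\ a = a', b = b', c = c' & d = d'].
Proof.
move=> /matrixP h.
by have := h 0 0; have := h 0 1; have := h 1 0; have := h 1 1; rewrite !mx2E.
Qed.

Lemma mx2M a b c d a' b' c' d' : mx2 a b c d * mx2 a' b' c' d' =
  mx2 (a * a' + b * c') (a * b' + b * d') (c * a' + d * c') (c * b' + d * d').
Proof.
rewrite [LHS]mx2_eta; congr mx2;
  by rewrite -mulmxE mxE !big_ord_recl big_ord0 addr0 !mxE.
Qed.

Lemma mx2D a b c d a' b' c' d' :
  mx2 a b c d + mx2 a' b' c' d' = mx2 (a + a') (b + b') (c + c') (d + d').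
Proof. by rewrite [LHS]mx2_eta !mxE. Qed.

Lemma mx2Z t a b c d : t *: mx2 a b c d = mx2 (t * a) (t * b) (t * c) (t * d).
Proof. by rewrite [LHS]mx2_eta !mxE. Qed.

Lemma mx2_1 : (1 : 'M[k]_2) = mx2 1 0 0 1.
Proof. by rewrite [LHS]mx2_eta !mxE. Qed.

Lemma mx2_0 : (0 : 'M[k]_2) = mx2 0 0 0 0.
Proof. by rewrite [LHS]mx2_eta !mxE. Qed.

Lemma det_mx2 a b c d : \det (mx2 a b c d) = a * d - b * c.
Proof.
rewrite (expand_det_row _ 0) !big_ord_recl big_ord0 addr0 /cofactor !det_mx11.
by rewrite !mxE /= !expr0 !expr1; ring.
Qed.

Lemma unitmx2 m : (m \is a GRing.unit) = (\det m != 0).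
Proof. by rewrite -unitfE -unitmxE. Qed.

Lemma mx2V a b c d : a * d - b * c != 0 ->
  (mx2 a b c d)^-1 = (a * d - b * c)^-1 *: mx2 d (- b) (- c) a.
Proof.
move=> h; have u : mx2 a b c d \is a GRing.unit by rewrite unitmx2 det_mx2.
apply: (mulrI u); rewrite divrr // mx2Z mx2M mx2_1.
by congr mx2; field.
Qed.

Lemma conj_by1 n : conj_by 1 n = n.
Proof. by rewrite /conj_by invr1 mulr1 mul1r. Qed.

Lemma conj_byM g h n : g \is a GRing.unit -> h \is a GRing.unit ->
  conj_by (g * h) n = conj_by g (conj_by h n).
Proof. by move=> gu hu; rewrite /conj_by invrM // !mulrA. Qed.

Lemma conj_byK g n : g \is a GRing.unit -> conj_by g^-1 (conj_by g n) = n.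
Proof. by move=> gu; rewrite -conj_byM ?unitrV // mulVr // conj_by1. Qed.

Lemma conj_byVK g n : g \is a GRing.unit -> conj_by g (conj_by g^-1 n) = n.
Proof. by move=> gu; rewrite -conj_byM ?unitrV // mulrV // conj_by1. Qed.

Lemma conj_byP g n n' : g \is a GRing.unit -> conj_by g n = n' <-> g * n = n' * g.
Proof.
move=> gu; rewrite /conj_by; split=> [<-|->]; first by rewrite -mulrA mulVr ?mulr1.
by rewrite -mulrA mulrV ?mulr1.
Qed.

Lemma conj_by_mul g n n' : g \is a GRing.unit ->
  conj_by g (n * n') = conj_by g n * conj_by g n'.
Proof. by move=> gu; rewrite /conj_by !mulrA mulrVK. Qed.

Lemma conj_by_unit g : g \is a GRing.unit -> conj_by g 1 = 1.
Proof. by move=> gu; rewrite /conj_by mulr1 mulrV. Qed.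

Lemma conj_byD g n n' : conj_by g (n + n') = conj_by g n + conj_by g n'.
Proof. by rewrite /conj_by mulrDr mulrDl. Qed.

Lemma conj_byZ g t n : conj_by g (t *: n) = t *: conj_by g n.
Proof. by rewrite /conj_by -scalerAr -scalerAl. Qed.

Lemma conj_by0 g : conj_by g 0 = 0.
Proof. by rewrite /conj_by mulr0 mul0r. Qed.

Lemma conj_by_scale t g n : t != 0 -> g \is a GRing.unit ->
  conj_by (t *: g) n = conj_by g n.
Proof.
move=> t0 gu; rewrite /conj_by invrZ ?unitfE // -!scalerAl -!scalerAr scalerA.
by rewrite divff // scale1r.
Qed.

Lemma det_conj_by g n : g \is a GRing.unit -> \det (conj_by g n) = \det n.
Proof.
move=> gu; rewrite /conj_by !detM detV mulrC mulrA mulVf ?mul1r //.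
by rewrite -unitmx2.
Qed.

Lemma conj_by_imageE g (E : set 'M[k]_2) n : g \is a GRing.unit ->
  (conj_by g @` E) n <-> E (conj_by g^-1 n).
Proof.
move=> gu; split=> [[x hx <-]|h]; first by rewrite conj_byK.
by exists (conj_by g^-1 n) => //; rewrite conj_byVK.
Qed.

(** The off-diagonal entries of n^2 are b(a + d) and c(a + d). A nonzero trace would force b = c =
    0, then a^2 = d^2 = 0 and n = 0. *)
Lemma nilpotent_mx2P n : n != 0 -> n * n = 0 ->
  exists x y z, n = mx2 x y z (- x) /\ x * x + y * z = 0.
Proof.
rewrite [n]mx2_eta; set a := n 0 0; set b := n 0 1; set c := n 1 0; set d := n 1 1.
move=> n0; rewrite mx2M mx2_0 => /mx2_inj [h1 h2 h3 h4].
suff td : d = - a by exists a, b, c; rewrite td.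
apply/eqP; rewrite -addr_eq0; apply/negP => /negP t0.
have b0 : b = 0.
  by apply: (mulIf t0); rewrite mul0r -h2; ring.
have c0 : c = 0.
  by apply: (mulIf t0); rewrite mul0r -h3; ring.
move: h1 h4; rewrite b0 c0 !mul0r addr0 add0r => /eqP; rewrite mulf_eq0 orbb => /eqP a0.
move=> /eqP; rewrite mulf_eq0 orbb => /eqP d0.
by move: n0; rewrite a0 b0 c0 d0 mx2_0 eqxx.
Qed.

Definition conj_group (G : set 'M[k]_2) : Prop :=
  [/\ forall g, G g -> g \is a GRing.unit, G 1,
      forall g h, G g -> G h -> G (g * h) & forall g, G g -> G g^-1].

Lemma order_normalizer_group (E : set 'M[k]_2) : conj_group (order_normalizer E).
Proof.
have comp g h : g \is a GRing.unit -> h \is a GRing.unit ->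
    conj_by (g * h) @` E = conj_by g @` (conj_by h @` E).
  by move=> gu hu; rewrite image_comp; apply: eq_imagel => n _; rewrite /= conj_byM.
split=> [g [] //||g h [gu gE] [hu hE]|g [gu gE]].
- split; first exact: unitr1.
  by rewrite -[RHS]image_id; apply: eq_imagel => n _; rewrite conj_by1.
- by split; [rewrite unitrMl|rewrite comp // hE].
- split; first by rewrite unitrV.
  rewrite -[in LHS]gE -comp ?unitrV // mulVr //.
  by rewrite -[RHS]image_id; apply: eq_imagel => n _; rewrite conj_by1.
Qed.

Lemma scalar_units_group (E : set 'M[k]_2) : E 1 ->
  (forall m n, E m -> E n -> E (m * n)) -> conj_group (scalar_units E).
Proof.
move=> E1 EM.
have uu u : unit_group E u -> u \is a GRing.unit.
  by move=> [_ [u' [_ h1 h2]]]; apply/unitrP; exists u'.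
split.
- move=> _ [a [u [a0 hu ->]]].
  by rewrite scaler_unit ?unitfE //; apply: uu.
- exists 1, 1; split; [exact: oner_neq0| |by rewrite scale1r].
  by split=> //; exists 1; split=> //; rewrite mulr1.
- move=> _ _ [a [u [a0 [uE [u' [u'E h1 h2]]] ->]]] [b [w [b0 [wE [w' [w'E h3 h4]]] ->]]].
  exists (a * b), (u * w); split; first by rewrite mulf_neq0.
    split; first exact: EM.
    exists (w' * u'); split; first exact: EM.
      by rewrite mulrA -[u * w * w']mulrA h3 mulr1.
    by rewrite mulrA -[w' * u' * u]mulrA h2 mulr1.
  by rewrite -scalerAl -scalerAr scalerA.
- move=> _ [a [u [a0 hu ->]]]; exists a^-1, u^-1; split.
  + by rewrite invr_eq0.
  + have uU := uu _ hu; case: hu => uE [u' [u'E h1 h2]].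
    have -> : u^-1 = u' by apply: (mulrI uU); rewrite h1 divrr.
    by split=> //; exists u.
  + by rewrite invrZ ?unitfE //; apply: uu.
Qed.

End Matrices.

(** * The standard Eichler order *)

Section Standard.
Variables (k : fieldType) (v : k -> int).
Hypothesis hv : discrete_valuation v.
Variable pi : k.
Hypothesis hpi : uniformizer v pi.
Local Notation O := (val_ge v 0).

Definition eichler0 (r : nat) : set 'M[k]_2 :=
  [set m | [/\ O (m 0 0), O (m 0 1), val_ge v r%:Z (m 1 0) & O (m 1 1)]].

(** The last condition reads kn ∩ E = On. For the orders E at hand it already makes the whole order
    O[n] optimal, by [opt_nilpotentP]. *)
Definition opt_nilpotent (E : set 'M[k]_2) : set 'M[k]_2 :=
  [set n | [/\ n != 0, n * n = 0 & forall y, E (y *: n) <-> O y]].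

Definition conj_rel (G : set 'M[k]_2) (n n' : 'M[k]_2) : Prop :=
  exists2 g, G g & conj_by g n = n'.

Definition conj_unit_rel (G : set 'M[k]_2) (n n' : 'M[k]_2) : Prop :=
  exists2 u, val_unit v u & conj_rel G n (u *: n').

Variable r : nat.
Local Notation E0 := (eichler0 r).

Lemma eichler0_mx2 a b c d : E0 (mx2 a b c d) = [/\ O a, O b, val_ge v r%:Z c & O d].
Proof. by rewrite /eichler0 /= !mx2E. Qed.

Lemma eichler0_1 : E0 1.
Proof.
by rewrite mx2_1 eichler0_mx2; split; try exact: val_ge_1; left.
Qed.

Lemma eichler0M m n : E0 m -> E0 n -> E0 (m * n).
Proof.
rewrite [m]mx2_eta [n]mx2_eta mx2M !eichler0_mx2 => -[? ? ? ?] [? ? ? ?].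
split; apply: val_geD => //; try exact: val_geMl; try exact: val_geMr.
- by apply: val_geMl => //; apply: (val_geW (n := r%:Z)).
- by apply: val_geMr => //; apply: (val_geW (n := r%:Z)).
Qed.

Lemma eichler0_lin a m n : O a -> E0 m -> E0 n -> E0 (a *: m + n).
Proof.
rewrite [m]mx2_eta [n]mx2_eta mx2Z mx2D !eichler0_mx2 => ? [? ? ? ?] [? ? ? ?].
by split; apply: val_geD => //; apply: val_geMl.
Qed.

Lemma eichler0_det m : E0 m -> O (\det m).
Proof.
rewrite [m]mx2_eta det_mx2 eichler0_mx2 => -[? ? ? ?].
apply: val_geB => //; apply: val_geMl => //.
exact: (val_geW (n := r%:Z)).
Qed.

Lemma unit_group0P m : unit_group E0 m <-> E0 m /\ val_unit v (\det m).
Proof.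
split=> [[hm [m' [hm' h _]]]|[]].
  split=> //; have := eichler0_det hm'; have := eichler0_det hm.
  have := congr1 determinant h; rewrite detM det1 => {}h.
  have m0 : \det m != 0.
    by apply/eqP => m0; move: h; rewrite m0 mul0r => /esym/eqP; rewrite oner_eq0.
  have m'0 : \det m' != 0.
    by apply/eqP => m'0; move: h; rewrite m'0 mulr0 => /esym/eqP; rewrite oner_eq0.
  have vdd : v (\det m) + v (\det m') = 0 by rewrite -valuationM // h valuation1.
  by rewrite !val_geE // => d d'; split=> //; lia.
move=> hm hu; split=> //; have hdet := hu; case: hu => d0 _.
have mu : m \is a GRing.unit by rewrite unitmx2.
exists m^-1; split; [|by rewrite mulrV|by rewrite mulVr].
move: hm hdet d0; rewrite [m]mx2_eta det_mx2 eichler0_mx2 => -[h1 h2 h3 h4] hu d0.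
rewrite mx2V // mx2Z; have /(val_unit_ge) hi := val_unitV hv hu.
by rewrite eichler0_mx2; split; apply: val_geMl => //; rewrite (val_geN hv).
Qed.

(* The lower left entry is divided by [pi ^+ r] so that conjugation by [atkin_mx]
   exchanges [y] and [z]. *)
Definition nilp_mx x y z : 'M[k]_2 := mx2 x y (pi ^+ r * z) (- x).

Definition nilp_coord x y z : Prop :=
  [/\ x * x + pi ^+ r * (y * z) = 0, O x, O y, O z & val_unit v y \/ val_unit v z].

Lemma val_ge_unifM n z : val_ge v (r%:Z + n) (pi ^+ r * z) = val_ge v n z.
Proof.
rewrite (val_geZ hv) ?(unifX_neq0 hpi) // (val_unifX hv hpi).
by rewrite (_ : r%:Z + n - r%:Z = n) //; lia.
Qed.

Lemma val_ge_unifM0 z : val_ge v r%:Z (pi ^+ r * z) = O z.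
Proof. by rewrite -[r%:Z]addr0 val_ge_unifM. Qed.

Lemma nil0Z u x y z : u *: nilp_mx x y z = nilp_mx (u * x) (u * y) (u * z).
Proof. by rewrite /nilp_mx mx2Z; congr mx2; ring. Qed.

Lemma nilp_coordZ u x y z : val_unit v u -> nilp_coord x y z -> nilp_coord (u * x) (u * y) (u * z).
Proof.
move=> hu [h1 h2 h3 h4 h5]; have hu0 := val_unit_ge hu.
split; try exact: val_geMl.
  by rewrite -[0](mulr0 (u * u)) -h1; ring.
by case: h5 => ?; [left|right]; apply: val_unitM.
Qed.

(** If neither y nor z were a unit, then x^2 = - pi^r y z would be divisible by pi^2, so x by pi,
    and n / pi would lie in E0 against optimality. Conversely a unit among y and z detects the
    integrality of t in t n. *)
Lemma opt_nilpotent0P n :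
  opt_nilpotent E0 n <-> exists x y z, n = nilp_mx x y z /\ nilp_coord x y z.
Proof.
split.
  move=> [n0 nn nE]; have [x [y [z' [nE' hx]]]] := nilpotent_mx2P n0 nn.
  rewrite {n0 nn}nE' in nE *.
  have /nE : O 1 by apply: val_ge_1.
  pose z := z' / pi ^+ r.
  have zE : z' = pi ^+ r * z by rewrite mulrC divfK ?(unifX_neq0 hpi).
  rewrite scale1r eichler0_mx2 zE val_ge_unifM0 => -[Ox Oy Oz _].
  exists x, y, z; split; first by rewrite /nilp_mx -zE.
  split=> //; first by rewrite -hx zE; ring.
  apply: contrapT => /not_orP [yN zN].
  have y1 : val_ge v 1 y by apply: contrapT => ?; apply: yN; apply/val_unitE.
  have z1 : val_ge v 1 z by apply: contrapT => ?; apply: zN; apply/val_unitE.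
  have x1 : val_ge v 1 x.
    apply: (val_ge_sqr hv (n := 2)) => //.
    have -> : x * x = - (z' * y) by rewrite [z' * y]mulrC; apply/eqP; rewrite -addr_eq0 hx.
    rewrite (val_geN hv); rewrite zE -mulrA.
    apply: val_geMl => //; first by apply: val_geW (unifX_ge hv hpi r) _; lia.
    by apply: (val_geM hv (m := 1) (n := 1)).
  have : O pi^-1.
    apply/nE; rewrite mx2Z eichler0_mx2.
    have h t (q : int) : val_ge v (q + 1) t -> val_ge v q (pi^-1 * t).
      rewrite -[pi]expr1 mulrC => ht; rewrite (val_ge_div hv hpi).
      exact: ht.
    split; apply: h => //.
      by rewrite zE val_ge_unifM.
    by rewrite (val_geN hv).
  rewrite val_geE ?invr_eq0 ?(unif_neq0 hpi) // valuationV ?(unif_neq0 hpi) //.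
  by rewrite (val_unif hpi).
move=> [x [y [z [-> [h1 h2 h3 h4 h5]]]]]; split.
- apply/eqP; rewrite /nilp_mx mx2_0 => /mx2_inj [x0 y0 /eqP z0 _].
  move: z0 h5; rewrite mulf_eq0 (negPf (unifX_neq0 hpi r)) /= => /eqP z0.
  by rewrite y0 z0 => -[] [/eqP].
- rewrite /nilp_mx mx2M mx2_0; congr mx2; try ring; rewrite -h1; ring.
- move=> t; rewrite nil0Z /nilp_mx eichler0_mx2 val_ge_unifM0 (val_geN hv).
  split=> [[_ ty tz _]|tO]; last by split; apply: val_geMl.
  case: h5 => -[n0 n1].
    by move: ty; rewrite mulrC val_geZ // n1 subr0.
  by move: tz; rewrite mulrC val_geZ // n1 subr0.
Qed.

(** * Conjugacy under Gamma_1 and Gamma_2 for the standard order *)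

Local Notation G1 := (scalar_units E0).
Local Notation G2 := (order_normalizer E0).

Lemma scalar_units0_group : conj_group G1.
Proof. by apply: scalar_units_group; [apply: eichler0_1|apply: eichler0M]. Qed.

Lemma scalar_units0P g : G1 g <-> exists t a b c d,
  [/\ t != 0, [/\ O a, O b, O c & O d], val_unit v (a * d - pi ^+ r * (b * c))
    & g = t *: mx2 a b (pi ^+ r * c) d].
Proof.
split.
  move=> [t [u [t0 /unit_group0P [hu du] ->]]].
  exists t, (u 0 0), (u 0 1), (u 1 0 / pi ^+ r), (u 1 1).
  have zE : u 1 0 = pi ^+ r * (u 1 0 / pi ^+ r) by rewrite [RHS]mulrC divfK ?(unifX_neq0 hpi).
  case: hu => h1 h2 h3 h4; split=> //.
  - by split=> //; rewrite (val_ge_div hv hpi) add0r.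
  - move: du; rewrite {1}[u]mx2_eta det_mx2 {1}zE.
    by rewrite mulrCA.
  - by rewrite -zE -mx2_eta.
move=> [t [a [b [c [d [t0 [h1 h2 h3 h4] hu ->]]]]]].
exists t, (mx2 a b (pi ^+ r * c) d); split=> //; apply/unit_group0P; split.
  by rewrite eichler0_mx2 val_ge_unifM0.
by rewrite det_mx2 [b * _]mulrCA.
Qed.

(** The four equations are the entries of g n = n' g for g = [a, b; pi^r c, d], with pi^r cancelled
    in the lower left one, so that no inverse of g is ever computed. *)
Lemma conj_rel_mx2 a b c d x y z x' y' z' :
  O a -> O b -> O c -> O d -> val_unit v (a * d - pi ^+ r * (b * c)) ->
  a * x + pi ^+ r * (b * z) = x' * a + pi ^+ r * (y' * c) ->
  a * y - b * x = x' * b + y' * d ->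
  c * x + d * z = z' * a - x' * c ->
  pi ^+ r * (c * y) - d * x = pi ^+ r * (z' * b) - x' * d ->
  conj_rel G1 (nilp_mx x y z) (nilp_mx x' y' z').
Proof.
move=> ha hb hc hd hu e1 e2 e3 e4.
have hG : G1 (mx2 a b (pi ^+ r * c) d).
  apply/scalar_units0P; exists 1, a, b, c, d.
  by rewrite scale1r oner_neq0; split.
exists (mx2 a b (pi ^+ r * c) d) => //.
apply/conj_byP; first by case: scalar_units0_group => + _ _ _; apply.
rewrite /nilp_mx !mx2M; congr mx2.
- by rewrite -[RHS]/(x' * a + y' * (pi ^+ r * c)) mulrCA [y' * _]mulrCA.
- by rewrite -e2; ring.
- transitivity (pi ^+ r * (c * x + d * z)); first by ring.
  by rewrite e3; ring.
- transitivity (pi ^+ r * (c * y) - d * x); first by ring.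
  by rewrite e4; ring.
Qed.

(** For y a unit, z is determined by x and y, and a lower triangular conjugator suffices: the upper
    right entry allows the diagonal (y', y), and the upper left one then forces c = (x - x') / pi^r,
    which the congruence makes integral. *)
Lemma conj_rel_unit_y x y z x' y' z' : nilp_coord x y z -> nilp_coord x' y' z' ->
  val_unit v y -> val_unit v y' -> val_ge v r%:Z (x - x') ->
  conj_rel G1 (nilp_mx x y z) (nilp_mx x' y' z').
Proof.
move=> [h1 h2 h3 h4 _] [h1' h2' h3' h4' _] hy hy' hx.
have p0 := unifX_neq0 hpi r; have [y0 _] := hy; have [y'0 _] := hy'.
have zE : z = - (x * x) / (pi ^+ r * y).
  apply: (mulfI (mulf_neq0 p0 y0)); rewrite [RHS]mulrC divfK ?mulf_neq0 //.
  by apply/eqP; rewrite -addr_eq0 -mulrA addrC h1.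
have zE' : z' = - (x' * x') / (pi ^+ r * y').
  apply: (mulfI (mulf_neq0 p0 y'0)); rewrite [RHS]mulrC divfK ?mulf_neq0 //.
  by apply/eqP; rewrite -addr_eq0 -mulrA addrC h1'.
apply: (@conj_rel_mx2 y' 0 ((x - x') / pi ^+ r) y) => //.
- by left.
- by rewrite (val_ge_div hv hpi) add0r.
- by rewrite mul0r mulr0 subr0; apply: val_unitM.
- by field.
- by ring.
- by rewrite zE zE'; field; rewrite ?p0 ?y0 ?y'0.
- by field.
Qed.

(** Mirror image of the previous case: y is determined by x and z, and the conjugator is upper
    triangular. *)
Lemma conj_rel_unit_z x y z x' y' z' : nilp_coord x y z -> nilp_coord x' y' z' ->
  val_unit v z -> val_unit v z' -> val_ge v r%:Z (x - x') ->
  conj_rel G1 (nilp_mx x y z) (nilp_mx x' y' z').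
Proof.
move=> [h1 h2 h3 h4 _] [h1' h2' h3' h4' _] hz hz' hx.
have p0 := unifX_neq0 hpi r; have [z0 _] := hz; have [z'0 _] := hz'.
have yE : y = - (x * x) / (pi ^+ r * z).
  apply: (mulfI (mulf_neq0 p0 z0)); rewrite [RHS]mulrC divfK ?mulf_neq0 //.
  by apply/eqP; rewrite -addr_eq0 -mulrA [z * y]mulrC addrC h1.
have yE' : y' = - (x' * x') / (pi ^+ r * z').
  apply: (mulfI (mulf_neq0 p0 z'0)); rewrite [RHS]mulrC divfK ?mulf_neq0 //.
  by apply/eqP; rewrite -addr_eq0 -mulrA [z' * y']mulrC addrC h1'.
apply: (@conj_rel_mx2 z ((x' - x) / pi ^+ r) 0 z') => //.
- by rewrite (val_ge_div hv hpi) add0r -(val_geN hv) opprB.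
- by left.
- by rewrite mulr0 mulr0 subr0; apply: val_unitM.
- by field.
- by rewrite yE yE'; field; rewrite ?p0 ?z0 ?z'0.
- by ring.
- by field.
Qed.

Lemma nilp_coord_sqr x y z : nilp_coord x y z -> x * x = pi ^+ r * (y * - z).
Proof.
by move=> [h _ _ _ _]; apply/eqP; rewrite -subr_eq0 -h; apply/eqP; ring.
Qed.

Lemma nilp_coord_ge x y z : nilp_coord x y z -> val_ge v (uphalf r)%:Z x.
Proof.
move=> hg; apply: (val_ge_sqr hv (n := r%:Z)); last by lia.
rewrite (nilp_coord_sqr hg) val_ge_unifM0; case: hg => _ _ hy hz _.
by apply: val_geMl => //; rewrite (val_geN hv).
Qed.

(** A factor pi in y or z makes x^2 divisible by pi^(r+1). For even r this excludes v(x) = r/2; for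
    odd r the bound agrees with that of [nilp_coord_ge]. *)
Lemma nilp_coord_ge_gt x y z : nilp_coord x y z -> ~ (val_unit v y /\ val_unit v z) ->
  val_ge v (r./2.+1)%:Z x.
Proof.
move=> hg hn; apply: (val_ge_sqr hv (n := r%:Z + 1)); last by lia.
rewrite (nilp_coord_sqr hg) val_ge_unifM; case: hg => _ _ hy hz _.
have [y1|y1] := pselect (val_ge v 1 y).
  by apply: val_geMr => //; rewrite (val_geN hv).
have [z1|z1] := pselect (val_ge v 1 z).
  by apply: val_geMl => //; rewrite (val_geN hv).
by case: hn; split; apply/val_unitE.
Qed.

Lemma nilp_coord_both_units x y z : nilp_coord x y z -> val_unit v y -> val_unit v z ->
  x != 0 /\ v x + v x = r%:Z.
Proof.
move=> hg [y0 vy] [z0 vz]; have xx := nilp_coord_sqr hg.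
have x0 : x != 0.
  apply/eqP => x0; move/esym/eqP: xx; rewrite x0 mul0r !mulf_eq0 oppr_eq0.
  by rewrite (negPf y0) (negPf z0) (negPf (unifX_neq0 hpi r)).
split=> //; rewrite -valuationM // xx valuationM ?mulf_neq0 ?oppr_eq0 ?(unifX_neq0 hpi) //.
by rewrite valuationM ?oppr_eq0 // valuationN // (val_unifX hv hpi) vy vz !addr0.
Qed.

(** For r > 0 a matrix of E0^* is upper triangular modulo pi, so its diagonal entries a and d are
    units. The upper left entry of g n = n' g modulo pi^r gives a(x - x') = 0; the upper right one
    modulo pi gives a y = d y', because pi divides x and x'. The converse splits on which of y and z
    is a unit. *)
Lemma conj_rel0P x y z x' y' z' : (0 < r)%N -> nilp_coord x y z -> nilp_coord x' y' z' ->
  conj_rel G1 (nilp_mx x y z) (nilp_mx x' y' z') <->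
  val_ge v r%:Z (x - x') /\ (val_unit v y <-> val_unit v y').
Proof.
move=> r0 hg hg'; split; last first.
  move=> [hx hyy]; have [hy|hy] := pselect (val_unit v y).
    by apply: conj_rel_unit_y => //; apply/hyy.
  have hy' : ~ val_unit v y' by move/hyy.
  apply: conj_rel_unit_z => //.
    by case: hg => _ _ _ _ [].
  by case: hg' => _ _ _ _ [].
move=> [g gG]; have gu : g \is a GRing.unit by case: scalar_units0_group => + _ _ _; apply.
move: gG gu => /scalar_units0P [t [a [b [c [d [t0 [ha hb hc hd] hu ->]]]]]] gu.
move=> /(conj_byP _ _ gu); rewrite -scalerAl -scalerAr => /(scalerI t0).
rewrite /nilp_mx !mx2M => /mx2_inj [e1 e2 _ _].
have pi1 : val_ge v 1 (pi ^+ r) by apply: val_geW (unifX_ge hv hpi r) _; lia.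
have had : val_unit v (a * d).
  have := val_unitD_ge hv hu (_ : val_ge v 1 (pi ^+ r * (b * c))).
  by rewrite subrK; apply; apply: val_geMr => //; apply: val_geMl.
have unit_factor s t' : O s -> O t' -> val_unit v (s * t') -> val_unit v s.
  move=> hs ht [st0 vst]; move: st0; rewrite mulf_eq0 negb_or => /andP [s0 t'0].
  split=> //; move: hs ht vst; rewrite !val_geE // valuationM //; lia.
have hau := unit_factor _ _ ha hd had.
have hdu : val_unit v d by apply: (unit_factor _ a) => //; rewrite mulrC.
case: hg hg' => h1 h2 h3 h4 _ [h1' h2' h3' h4' _].
have x1 : val_ge v 1 x.
  apply: (val_ge_sqr hv (n := 1)) => //; rewrite (_ : x * x = - (pi ^+ r * (y * z))).
    by rewrite (val_geN hv); apply: val_geMr => //; apply: val_geMl.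
  by apply/eqP; rewrite -addr_eq0 h1.
have x1' : val_ge v 1 x'.
  apply: (val_ge_sqr hv (n := 1)) => //; rewrite (_ : x' * x' = - (pi ^+ r * (y' * z'))).
    by rewrite (val_geN hv); apply: val_geMr => //; apply: val_geMl.
  by apply/eqP; rewrite -addr_eq0 h1'.
split.
  have : val_ge v r%:Z (a * (x - x')).
    rewrite (_ : a * (x - x') = pi ^+ r * (y' * c - b * z)).
      by rewrite val_ge_unifM0; apply: val_geB => //; apply: val_geMl.
    apply/eqP; rewrite -subr_eq0 -(subrr (x' * a + y' * (pi ^+ r * c))) -{1}e1.
    by apply/eqP; ring.
  by case: hau => a0 va; rewrite val_geZ // va subr0.
have e2' : d * y' = a * y + - (b * (x + x')).
  by apply/eqP; rewrite -subr_eq0 -(subrr (x' * b + y' * d)) -{2}e2; apply/eqP; ring.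
have hb1 : val_ge v 1 (b * (x + x')) by apply: val_geMl => //; apply: val_geD.
split=> hy.
  apply: (unit_factor _ d) => //; rewrite mulrC e2'; apply: val_unitD_ge => //.
    exact: val_unitM.
  by rewrite (val_geN hv).
apply: (unit_factor _ a) => //; rewrite mulrC.
have -> : a * y = d * y' + b * (x + x') by rewrite e2' subrK.
by apply: val_unitD_ge => //; exact: val_unitM.
Qed.

(** The Atkin-Lehner element: its square is the scalar pi^r, and it exchanges M_2(O) with its
    conjugate by diag(1, pi^r), whose intersection is E0. *)
Definition atkin_mx : 'M[k]_2 := mx2 0 1 (pi ^+ r) 0.

Lemma det_atkin : \det atkin_mx = - pi ^+ r.
Proof. by rewrite det_mx2 mul0r mul1r sub0r. Qed.

Lemma atkin_unit : atkin_mx \is a GRing.unit.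
Proof. by rewrite unitmx2 det_atkin oppr_eq0 (unifX_neq0 hpi). Qed.

Lemma conj_atkin a b c d :
  conj_by atkin_mx (mx2 a b (pi ^+ r * c) d) = mx2 d c (pi ^+ r * b) a.
Proof.
by apply/conj_byP; rewrite ?atkin_unit // /atkin_mx !mx2M; congr mx2; ring.
Qed.

Lemma conj_atkin_nil0 x y z : conj_by atkin_mx (nilp_mx x y z) = nilp_mx (- x) z y.
Proof. by rewrite /nilp_mx conj_atkin opprK. Qed.

Lemma nilp_coord_atkin x y z : nilp_coord x y z -> nilp_coord (- x) z y.
Proof.
move=> [h1 h2 h3 h4 h5]; split=> //; last by case: h5; [right|left].
  by rewrite -h1; ring.
by rewrite (val_geN hv).
Qed.

Lemma normalizer_of_sub g : g \is a GRing.unit ->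
  (forall n, E0 n -> E0 (conj_by g n)) -> (forall n, E0 n -> E0 (conj_by g^-1 n)) -> G2 g.
Proof.
move=> gu h1 h2; split=> //; apply/seteqP; split=> [_ [n hn <-]|n hn].
  exact: h1.
by exists (conj_by g^-1 n); [exact: h2|rewrite conj_byVK].
Qed.

Lemma scalar_units0_sub_normalizer : G1 `<=` G2.
Proof.
move=> g gG; have [gunit _ _ ginv] := scalar_units0_group.
have aux h n : G1 h -> E0 n -> E0 (conj_by h n).
  move=> hG; have hu := gunit _ hG.
  move: hG hu => [t [u [t0 [uE [u' [u'E e1 e2]]] ->]]] hu hn.
  have uu : u \is a GRing.unit by apply/unitrP; exists u'.
  rewrite conj_by_scale // /conj_by.
  have -> : u^-1 = u' by apply: (mulrI uu); rewrite e1 divrr.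
  by apply: eichler0M => //; apply: eichler0M.
apply: normalizer_of_sub; [exact: gunit|move=> n; exact: aux|].
by move=> n; apply: aux; apply: ginv.
Qed.

Lemma atkin_normalizer : G2 atkin_mx.
Proof.
have aux n : E0 n -> E0 (conj_by atkin_mx n).
  have zE : n 1 0 = pi ^+ r * (n 1 0 / pi ^+ r).
    by rewrite [RHS]mulrC divfK ?(unifX_neq0 hpi).
  rewrite [n]mx2_eta zE conj_atkin !eichler0_mx2 !val_ge_unifM0.
  by move=> [? ? ? ?].
apply: normalizer_of_sub => //; first exact: atkin_unit.
(* Conjugation by [atkin_mx] is an involution, so the inverse is covered by [aux]. *)
move=> n hn; rewrite (_ : conj_by _ _ = conj_by atkin_mx n); first exact: aux.
have zE : n 1 0 = pi ^+ r * (n 1 0 / pi ^+ r).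
  by rewrite [RHS]mulrC divfK ?(unifX_neq0 hpi).
rewrite -{1}(_ : conj_by atkin_mx (conj_by atkin_mx n) = n) ?conj_byK ?atkin_unit //.
by rewrite [n]mx2_eta zE !conj_atkin.
Qed.

(** Conjugating e11, e12 and pi^r e21 by g = [A, B; C, D] yields products of two entries of g over
    [dl] = det g, subject to the integrality conditions of E0. As AD/dl - BC/dl = 1, one of these
    two terms is a unit. In the first case 2v(A) and 2v(D) are at least v(dl) and add up to 2v(dl),
    so both are equalities and g / A lies in E0^*. In the second case 2v(B) and 2v(C) are likewise
    v(dl) - r and v(dl) + r, and g w^-1 / B lies in E0^*. *)
Lemma order_normalizer0P g : G2 g <-> G1 g \/ G1 (g * atkin_mx^-1).
Proof.
have [_ _ G2M _] := order_normalizer_group E0.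
split; last first.
  move=> [/scalar_units0_sub_normalizer //|/scalar_units0_sub_normalizer h].
  rewrite -[g](mulrVK atkin_unit); apply: G2M => //; exact: atkin_normalizer.
move=> [gu gE].
have stab n : E0 n -> E0 (conj_by g n) by move=> hn; rewrite -gE; exists n.
move: gu stab; rewrite {gE} [g]mx2_eta.
set A := g 0 0; set B := g 0 1; set C := g 1 0; set D := g 1 1.
rewrite unitmx2 det_mx2; set dl := A * D - B * C => dl0 stab.
have conjE a b c d : conj_by (mx2 A B C D) (mx2 a b c d) =
    dl^-1 *: (mx2 A B C D * mx2 a b c d * mx2 D (- B) (- C) A).
  by rewrite /conj_by mx2V // -scalerAr.
have O0 : O 0 by left.
have O1 : O 1 by apply: val_ge_1.
have r0 : val_ge v r%:Z 0 by left.
have di0 : dl^-1 != 0 by rewrite invr_eq0.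
have [AD AB CD CB] : [/\ O (dl^-1 * (A * D)), O (dl^-1 * (A * B)),
    val_ge v r%:Z (dl^-1 * (C * D)) & O (dl^-1 * (B * C))].
  have /stab : E0 (mx2 1 0 0 0) by rewrite eichler0_mx2.
  rewrite conjE !mx2M mx2Z eichler0_mx2 !(mulr0, mulr1, mul0r, addr0, add0r).
  rewrite !mulrN !(val_geN hv) => -[h1 h2 h3 h4]; split=> //.
  by rewrite [B * C]mulrC.
have [AA CC] : O (dl^-1 * (A * A)) /\ val_ge v r%:Z (dl^-1 * (C * C)).
  have /stab : E0 (mx2 0 1 0 0) by rewrite eichler0_mx2.
  rewrite conjE !mx2M mx2Z eichler0_mx2 !(mulr0, mulr1, mul0r, addr0, add0r).
  by rewrite !mulrN !(val_geN hv) => -[h1 h2 h3 h4]; split.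
have [BB DD] : O (dl^-1 * (pi ^+ r * (B * B))) /\ O (dl^-1 * (D * D)).
  have /stab : E0 (mx2 0 0 (pi ^+ r * 1) 0) by rewrite eichler0_mx2 val_ge_unifM0.
  rewrite conjE !mx2M mx2Z eichler0_mx2 !(mulr0, mulr1, mul0r, addr0, add0r).
  rewrite !mulrN !(val_geN hv) => -[h1 h2 h3 h4].
  split; first by rewrite (_ : _ * (B * B) = B * pi ^+ r * B) //; ring.
  by move: h3; rewrite (_ : _ * _ = pi ^+ r * (dl^-1 * (D * D))); [rewrite val_ge_unifM0|ring].
have [|] : val_unit v (dl^-1 * (A * D)) \/ val_unit v (dl^-1 * (B * C)).
  have e1 : dl^-1 * (A * D) - dl^-1 * (B * C) = 1 by rewrite -mulrBr mulVf.
  have [h|h] := pselect (val_ge v 1 (dl^-1 * (A * D))); last by left; apply/val_unitE.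
  have [h'|h'] := pselect (val_ge v 1 (dl^-1 * (B * C))); last by right; apply/val_unitE.
  have := val_geB hv h h'; rewrite e1 val_geE ?oner_neq0 // valuation1 //.
- move=> [AD0 vAD]; left.
  have [A0 D0] : A != 0 /\ D != 0.
    by move: AD0; rewrite !mulf_eq0 !negb_or => /and3P [].
  have [vA vD] : v A + v A = v dl /\ v D + v D = v dl.
    move: AA DD vAD; rewrite !val_geE ?mulf_neq0 // !valuationM ?mulf_neq0 // valuationV //; lia.
  apply/scalar_units0P; exists A, 1, (B / A), (C / A / pi ^+ r), (D / A); split=> //.
  + split=> //.
    * rewrite mulrC val_geZ ?invr_eq0 // valuationV // opprK add0r.
      move: AB; rewrite !val_geZ // valuationV //; congr (val_ge v _ _); lia.
    * rewrite (val_ge_div hv hpi) add0r mulrC val_geZ ?invr_eq0 // valuationV //.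
      move: CD; rewrite [C * D]mulrC !val_geZ // valuationV //; congr (val_ge v _ _); lia.
    * rewrite val_geE ?mulf_neq0 ?invr_eq0 // valuationM ?invr_eq0 // valuationV //; lia.
  + rewrite (_ : _ - _ = dl / (A * A)).
      split; first by rewrite mulf_neq0 ?invr_eq0 ?mulf_neq0.
      by rewrite valuationM ?invr_eq0 ?mulf_neq0 // valuationV ?mulf_neq0 // valuationM //; lia.
    by rewrite /dl; field; rewrite A0 (unifX_neq0 hpi).
  + by rewrite mx2Z; congr mx2; field; rewrite ?A0 ?(unifX_neq0 hpi).
- move=> [BC0 vBC]; right.
  have [B0 C0] : B != 0 /\ C != 0.
    by move: BC0; rewrite !mulf_eq0 !negb_or => /and3P [].
  have p0 := unifX_neq0 hpi r.
  have [vB vC] : v B + v B = v dl - r%:Z /\ v C + v C = v dl + r%:Z.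
    move: BB CC vBC; rewrite !val_geE ?mulf_neq0 // !valuationM ?mulf_neq0 // valuationV //.
    rewrite (val_unifX hv hpi); lia.
  apply/scalar_units0P.
  (* These are the entries of g w^-1 = [B, A / pi^r; D, C / pi^r] divided by B. *)
  exists B, 1, (A / B / pi ^+ r), (D / B / pi ^+ r), (C / B / pi ^+ r); split=> //.
  + split=> //.
    * rewrite (val_ge_div hv hpi) add0r mulrC val_geZ ?invr_eq0 // valuationV //.
      move: AB; rewrite [A * B]mulrC !val_geZ // valuationV //; congr (val_ge v _ _); lia.
    * rewrite (val_ge_div hv hpi) add0r mulrC val_geZ ?invr_eq0 // valuationV //.
      move: CD; rewrite !val_geZ // valuationV //; congr (val_ge v _ _); lia.
    * rewrite (val_ge_div hv hpi) add0r val_geE ?mulf_neq0 ?invr_eq0 //.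
      rewrite valuationM ?invr_eq0 // valuationV //; lia.
  + rewrite (_ : _ - _ = - (dl / (pi ^+ r * (B * B)))).
      split; first by rewrite oppr_eq0 mulf_neq0 ?invr_eq0 ?mulf_neq0.
      rewrite valuationN // valuationM ?invr_eq0 ?mulf_neq0 // valuationV ?mulf_neq0 //.
      by rewrite !valuationM ?mulf_neq0 // (val_unifX hv hpi); lia.
    by rewrite /dl; field; rewrite B0 p0.
  + apply: (mulIr atkin_unit); rewrite mulrVK ?atkin_unit //.
    by rewrite mx2Z /atkin_mx mx2M; congr mx2; field; rewrite ?B0 ?p0.
Qed.

Lemma conj_rel_normalizer0P n n' :
  conj_rel G2 n n' <-> conj_rel G1 n n' \/ conj_rel G1 (conj_by atkin_mx n) n'.
Proof.
have [Gu _ _ _] := scalar_units0_group.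
split.
  move=> [g /order_normalizer0P [gG|gG] gn]; first by left; exists g.
  right; exists (g * atkin_mx^-1) => //.
  rewrite -conj_byM; [by rewrite (mulrVK atkin_unit)|exact: Gu|exact: atkin_unit].
move=> [] [g gG gn]; first by exists g => //; apply/order_normalizer0P; left.
exists (g * atkin_mx); last by rewrite conj_byM //; [exact: Gu|exact: atkin_unit].
by apply/order_normalizer0P; right; rewrite (mulrK atkin_unit).
Qed.

End Standard.

(** * Counting classes of nilpotent matrices *)

Section Classified.
Variable T : Type.
Implicit Types (X : set T) (R : T -> T -> Prop).

(* [R] is an equivalence relation on [X] with [e] classes. *)
Definition classified X R (e : nat) : Prop :=
  exists f : T -> nat,
    [/\ forall n n', X n -> X n' -> (R n n' <-> f n = f n'),
        forall n, X n -> (f n < e)%N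
      & forall i, (i < e)%N -> exists2 n, X n & f n = i].

(** Lets orbits be counted on representatives: [o] is the orbit map and the code descends to its
    image. The empty case is separate because choosing representatives needs a default element. *)
Lemma classified_card (U : Type) (o : T -> U) X R e :
  (forall n n', X n -> X n' -> (o n = o n' <-> R n n')) -> classified X R e ->
  o @` X #= `I_e.
Proof.
move=> oR [f [fR fe fs]].
have [Xe|/set0P [t0 Xt0]] := eqVneq X set0.
  rewrite Xe image_set0; case: e fe fs => [|e] fe fs; first by rewrite II0.
  by have [n] := fs 0%N isT; rewrite Xe.
have /choice [g gP] : forall u, exists t, (o @` X) u -> X t /\ o t = u.
  move=> u; have [[t Xt ot]|h] := pselect ((o @` X) u); first by exists t.
  by exists t0.
apply/card_set_bijP; exists (f \o g); split.
- by move=> u /gP [Xg _] /=; apply: fe.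
- move=> u u'; rewrite !inE => /gP [Xg og] /gP [Xg' og'] /= h.
  by rewrite -og -og'; apply/oR => //; apply/fR.
- move=> i /= /fs [n Xn fn]; exists (o n); first by exists n.
  have [Xg og] := gP (o n) (ex_intro2 _ _ n Xn erefl).
  by rewrite -fn; apply/fR => //; apply/oR.
Qed.

(** The map [s] induces on the codes 0, ..., e - 1 an involution [tau] without fixed points, whose
    orbits are the classes of R'. Each orbit has two elements, and the smaller one serves as its
    code. *)
Lemma classified_involution X R R' (s : T -> T) e :
  classified X R e ->
  (forall n, X n -> X (s n)) -> (forall n, X n -> s (s n) = n) ->
  (forall n n', X n -> X n' -> R n n' -> R (s n) (s n')) ->
  (forall n, X n -> ~ R (s n) n) ->
  (forall n n', X n -> X n' -> (R' n n' <-> R n n' \/ R (s n) n')) ->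
  exists2 e', e = e'.*2 & classified X R' e'.
Proof.
move=> [f [fR fe fs]] Xs ss sR sfree R'E.
have [Xe|/set0P [t0 Xt0]] := eqVneq X set0.
  have e0 : e = 0%N.
    by case: e fe fs => // e fe fs; have [n] := fs 0%N isT; rewrite Xe.
  by exists 0%N; [rewrite e0|exists (fun=> 0%N); rewrite Xe; split].
have /choice [g gP] : forall i, exists n, (i < e)%N -> X n /\ f n = i.
  move=> i; case: (ltnP i e) => [/fs [n Xn fn]|_]; first by exists n.
  by exists t0.
pose tau i := f (s (g i)).
have fsE n : X n -> f (s n) = tau (f n).
  move=> Xn; have [Xg fg] := gP _ (fe _ Xn).
  by apply/fR; [exact: Xs|exact: Xs|apply: sR => //; apply/fR].
have tau_lt i : (i < e)%N -> (tau i < e)%N by move=> /gP [Xg _]; apply/fe/Xs.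
have tauK i : (i < e)%N -> tau (tau i) = i.
  by move=> /gP [Xg fg]; rewrite -fsE ?ss //; apply: Xs.
have tau_neq i : (i < e)%N -> tau i != i.
  move=> /gP [Xg fg]; apply/eqP => ti; apply: (sfree _ Xg).
  by apply/fR => //; [exact: Xs|rewrite fg].
(* [l] lists the smaller element of each orbit of [tau]; [tau] maps it bijectively onto the
   remaining codes, so e is twice its length. *)
pose l := [seq i <- iota 0 e | (i < tau i)%N].
have lP i : (i \in l) = (i < tau i)%N && (i < e)%N.
  by rewrite mem_filter mem_iota /= add0n.
have lu : uniq l by rewrite filter_uniq ?iota_uniq.
have el : e = (size l).*2.
  rewrite -[LHS](size_iota 0 e) -(count_predC (fun i => i < tau i)%N) -!size_filter.
  rewrite -addnn; congr (_ + _)%N; rewrite -[RHS](size_map tau); apply: perm_size.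
  apply: uniq_perm; first by rewrite filter_uniq ?iota_uniq.
    rewrite map_inj_in_uniq // => i j; rewrite !lP => /andP [_ ie] /andP [_ je].
    by move=> /(congr1 tau); rewrite !tauK.
  move=> i; rewrite mem_filter mem_iota /= add0n; apply/idP/mapP.
    move=> /andP [h ie]; exists (tau i); last by rewrite tauK.
    by rewrite lP tauK // tau_lt // andbT; have := tau_neq _ ie; lia.
  move=> [j]; rewrite lP => /andP [h je] ->.
  by rewrite tauK // tau_lt // andbT; lia.
pose h n := minn (f n) (f (s n)).
have hl n : X n -> h n \in l.
  move=> Xn; have ne := fe _ Xn; rewrite lP /h fsE //.
  have := tau_lt _ ne; have := tau_neq _ ne; rewrite /minn.
  by case: (ltnP (f n) (tau (f n))) => hh; rewrite ?tauK //; lia.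
exists (size l) => //; exists (fun n => index (h n) l); split.
- move=> n n' Xn Xn'.
  have -> : index (h n) l = index (h n') l <-> h n = h n'.
    split=> [hh|->//]; have := nth_index 0%N (hl _ Xn).
    by rewrite hh nth_index // hl.
  have Xsn := Xs _ Xn.
  apply: (iff_trans (R'E _ _ Xn Xn')); rewrite (fR _ _ Xn Xn') (fR _ _ Xsn Xn') /h.
  rewrite !fsE //; have := tauK _ (fe _ Xn); have := tauK _ (fe _ Xn').
  move=> t't' tt; split=> [[->//|e1]|].
    by rewrite -e1 tt minnC.
  rewrite /minn; case: ltnP => _; case: ltnP => _; first by left.
  + by move=> e1; right; rewrite e1.
  + by right.
  + by move=> e1; left; rewrite -tt e1 t't'.
- by move=> n Xn; rewrite index_mem; apply: hl.
- move=> i il; have := mem_nth 0%N il; rewrite lP => /andP [ht ie].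
  have [Xg fg] := gP _ ie; exists (g (nth 0%N l i)) => //.
  by rewrite /h fsE // fg /minn ht index_uniq.
Qed.

End Classified.

(** * The four counts for the standard order *)

Section Counting.
Variables (k : fieldType) (v : k -> int).
Hypothesis hv : discrete_valuation v.
Variable pi : k.
Hypothesis hpi : uniformizer v pi.
Variable r : nat.
Local Notation O := (val_ge v 0).
Local Notation E0 := (eichler0 v r).
Local Notation G1 := (scalar_units E0).
Local Notation G2 := (order_normalizer E0).
Local Notation nil0 := (nilp_mx pi r).
Local Notation good := (nilp_coord v pi r).
Local Notation atkin := (atkin_mx pi r).

Lemma classified_good (R : 'M[k]_2 -> 'M[k]_2 -> Prop) e (f : k -> k -> nat) :
  (forall x y z x' y' z', good x y z -> good x' y' z' ->
     (R (nil0 x y z) (nil0 x' y' z') <-> f x y = f x' y')) ->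
  (forall x y z, good x y z -> (f x y < e)%N) ->
  (forall i, (i < e)%N -> exists x y z, good x y z /\ f x y = i) ->
  classified (opt_nilpotent v E0) R e.
Proof.
move=> fR fe fs; exists (fun n => f (n 0 0) (n 0 1)); split.
- move=> n n' /(opt_nilpotent0P hv hpi) [x [y [z [-> h]]]].
  move=> /(opt_nilpotent0P hv hpi) [x' [y' [z' [-> h']]]].
  by rewrite /nilp_mx !mx2E; exact: (fR _ _ _ _ _ _ h h').
- move=> n /(opt_nilpotent0P hv hpi) [x [y [z [-> h]]]].
  by rewrite /nilp_mx !mx2E; exact: (fe _ _ _ h).
- move=> i /fs [x [y [z [h fi]]]]; exists (nil0 x y z).
    by apply/(opt_nilpotent0P hv hpi); exists x, y, z.
  by rewrite /nilp_mx !mx2E.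
Qed.

(** Provides the representatives with y = 1: the lower bound on v(x) is exactly what makes z
    integral. *)
Lemma nilp_coord_y x : val_ge v (uphalf r)%:Z x -> good x 1 (- (x * x) / pi ^+ r).
Proof.
move=> hx; have p0 := unifX_neq0 hpi r; split.
- by field.
- by apply: val_geW hx _; lia.
- exact: val_ge_1.
- rewrite (val_ge_div hv hpi) add0r (val_geN hv).
  by apply: val_geW (val_geM hv hx hx) _; lia.
- by left; apply: val_unit1.
Qed.

(** Provides the representatives with z = 1 and y not a unit: 2([r/2] + 1) > r leaves a factor pi in
    y. *)
Lemma nilp_coord_z x : val_ge v (r./2.+1)%:Z x ->
  good x (- (x * x) / pi ^+ r) 1 /\ ~ val_unit v (- (x * x) / pi ^+ r).
Proof.
move=> hx; have p0 := unifX_neq0 hpi r.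
have hy : val_ge v 1 (- (x * x) / pi ^+ r).
  rewrite (val_ge_div hv hpi) (val_geN hv).
  by apply: val_geW (val_geM hv hx hx) _; lia.
split; last by move/val_unitE => [_].
split.
- by field.
- by apply: val_geW hx _; lia.
- exact: val_geW hy _.
- exact: val_ge_1.
- by right; apply: val_unit1.
Qed.

Lemma nilp_coord_unit x y z : good x y z -> ~ val_unit v y -> val_unit v z.
Proof. by move=> [_ _ _ _ []]. Qed.

Lemma nilp_coord_O x y z : good x y z -> O x. Proof. by case. Qed.

Lemma nilp_coord_lt_not_both x y z : good x y z -> val_ge v (r./2.+1)%:Z x ->
  val_unit v y -> ~ val_unit v z.
Proof.
move=> h hx hy hz; have [x0 xx] := nilp_coord_both_units hv hpi h hy hz.
by move: hx; rewrite val_geE //; lia.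
Qed.

Lemma opt_nilpotent0_atkin n :
  opt_nilpotent v E0 n -> opt_nilpotent v E0 (conj_by atkin n).
Proof.
move=> /(opt_nilpotent0P hv hpi) [x [y [z [-> h]]]].
apply/(opt_nilpotent0P hv hpi); exists (- x), z, y.
by rewrite (conj_atkin_nil0 hpi); split=> //; apply: nilp_coord_atkin.
Qed.

Lemma conj_atkinK n : conj_by atkin (conj_by atkin n) = n.
Proof.
have zE : n 1 0 = pi ^+ r * (n 1 0 / pi ^+ r).
  by rewrite [RHS]mulrC divfK ?(unifX_neq0 hpi).
by rewrite [n]mx2_eta zE !(conj_atkin hpi).
Qed.

(** [atkin_mx] normalises Gamma_1: on [a, b; pi^r c, d] it exchanges a with d and b with c. *)
Lemma conj_rel_atkin n n' : conj_rel G1 n n' ->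
  conj_rel G1 (conj_by atkin n) (conj_by atkin n').
Proof.
have [Gu _ _ _] := scalar_units0_group hv r.
have wu := atkin_unit hpi r.
move=> [g gG <-]; have gu := Gu _ gG.
have hwg : G1 (conj_by atkin g).
  have [t [a [b [c [d [t0 [ha hb hc hd] hu ->]]]]]] := proj1 (scalar_units0P hv hpi r g) gG.
  apply/(scalar_units0P hv hpi); exists t, d, c, b, a; split=> //.
    by rewrite [d * a]mulrC [c * b]mulrC.
  by rewrite conj_byZ (conj_atkin hpi).
exists (conj_by atkin g) => //.
rewrite -!conj_byM //; last exact: Gu.
by rewrite {1}/conj_by (mulrVK wu).
Qed.

Lemma conj_unit_rel0P x y z x' y' z' : (0 < r)%N -> good x y z -> good x' y' z' ->
  conj_unit_rel v G1 (nil0 x y z) (nil0 x' y' z') <->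
  trunc_val v r x = trunc_val v r x' /\ (val_unit v y <-> val_unit v y').
Proof.
move=> r0 h h'.
have unitMl u t : val_unit v u -> val_unit v t <-> val_unit v (u * t).
  move=> hu; split=> [|ht]; first exact: val_unitM.
  by rewrite -[t](mulKf (proj1 hu)); apply: val_unitM => //; apply: val_unitV.
split.
  move=> [u hu]; rewrite nil0Z.
  move=> /(conj_rel0P hv hpi r0 h (nilp_coordZ hv hu h')) [h1 h2].
  split; last by apply: (iff_trans h2); apply: iff_sym; apply: unitMl.
  by apply/(trunc_val_eqP hv r (nilp_coord_O h) (nilp_coord_O h')); exists u.
move=> [/(trunc_val_eqP hv r (nilp_coord_O h) (nilp_coord_O h')) [u hu hx] hy].
exists u => //; rewrite nil0Z; apply/(conj_rel0P hv hpi r0 h (nilp_coordZ hv hu h')).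
by split=> //; apply: (iff_trans hy); apply: unitMl.
Qed.

Lemma trunc_valN x : trunc_val v r (- x) = trunc_val v r x.
Proof. by rewrite /trunc_val oppr_eq0 (valuationN hv). Qed.

(** The unit test on y disappears. If y is a unit and y' is not, then v(x') >= [r/2] + 1, hence also
    v(x), so z is not a unit and w moves (x, y, z) to a triple of the type of (x', y', z'). If y' is
    a unit and y is not, then z is a unit and w again serves. *)
Lemma conj_unit_rel_normalizer0P x y z x' y' z' :
  (0 < r)%N -> good x y z -> good x' y' z' ->
  conj_unit_rel v G2 (nil0 x y z) (nil0 x' y' z') <-> trunc_val v r x = trunc_val v r x'.
Proof.
move=> r0 h h'.
have split2 : conj_unit_rel v G2 (nil0 x y z) (nil0 x' y' z') <->
    conj_unit_rel v G1 (nil0 x y z) (nil0 x' y' z') \/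
    conj_unit_rel v G1 (nil0 (- x) z y) (nil0 x' y' z').
  split.
    move=> [u hu /(conj_rel_normalizer0P hv hpi)]; rewrite (conj_atkin_nil0 hpi).
    by move=> [|]; [left|right]; exists u.
  move=> [] [u hu hc]; exists u => //; apply/(conj_rel_normalizer0P hv hpi);
    rewrite (conj_atkin_nil0 hpi); by [left|right].
apply: (iff_trans split2).
have hs := nilp_coord_atkin hv h.
split=> [[/(conj_unit_rel0P r0 h h') []//|/(conj_unit_rel0P r0 hs h') []]|hx].
  by rewrite trunc_valN.
have [hy|hy] := pselect (val_unit v y); have [hy'|hy'] := pselect (val_unit v y').
- by left; apply/conj_unit_rel0P.
- right; apply/conj_unit_rel0P => //; rewrite trunc_valN; split=> //; split=> // hz.
  exfalso; apply: (nilp_coord_lt_not_both h _ hy hz).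
  rewrite -(trunc_val_geP (r := r) (nilp_coord_O h)) ?hx; last by lia.
  rewrite trunc_val_geP; [|exact: nilp_coord_O h'|lia].
  by apply: (nilp_coord_ge_gt hv hpi h' _) => // -[].
- right; apply/conj_unit_rel0P => //; rewrite trunc_valN; split=> //; split=> // _.
  exact: (nilp_coord_unit h hy).
- by left; apply/conj_unit_rel0P.
Qed.

Lemma classified_sub1 : (0 < r)%N ->
  classified (opt_nilpotent v E0) (conj_unit_rel v G1) r.+1.
Proof.
move=> r0.
(* Let t = min(v(x), r). For y a unit, t fills [uphalf r], ..., r and is its own code; otherwise t
   fills [r/2] + 1, ..., r, and r - t fills the remaining codes 0, ..., [uphalf r] - 1. *)
apply: (@classified_good _ _ (fun x y =>
  if `[< val_unit v y >] then trunc_val v r x else (r - trunc_val v r x)%N)).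
- move=> x y z x' y' z' h h'; apply: (iff_trans (conj_unit_rel0P r0 h h')).
  have le_tr x0 := trunc_val_le v r x0.
  have lo x0 y0 z0 : good x0 y0 z0 -> (uphalf r <= trunc_val v r x0)%N.
    move=> h0; rewrite (trunc_val_geP (nilp_coord_O h0)); last by lia.
    exact: (nilp_coord_ge hv hpi h0).
  have hi x0 y0 z0 : good x0 y0 z0 -> ~ val_unit v y0 ->
      (r./2.+1 <= trunc_val v r x0)%N.
    move=> h0 hy0; rewrite (trunc_val_geP (nilp_coord_O h0)); last by lia.
    by apply: (nilp_coord_ge_gt hv hpi h0 _) => // -[].
  have := lo _ _ _ h; have := lo _ _ _ h'; have := le_tr x; have := le_tr x'.
  case: asboolP => hy; case: asboolP => hy'.
  + by move=> *; tauto.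
  + by have := hi _ _ _ h' hy' => *; split; [tauto|lia].
  + by have := hi _ _ _ h hy => *; split; [tauto|lia].
  + by move=> *; split=> [[->//]|ee]; split; [lia|tauto].
- move=> x y z _; have := trunc_val_le v r x; case: ifP => _; lia.
- move=> i hi; case: (leqP (uphalf r) i) => hir.
    have hx : val_ge v (uphalf r)%:Z (pi ^+ i).
      by apply: val_geW (unifX_ge hv hpi i) _; lia.
    exists (pi ^+ i), 1, (- (pi ^+ i * pi ^+ i) / pi ^+ r); split; first exact: nilp_coord_y.
    case: asboolP => [_|[]]; last exact: val_unit1.
    by rewrite (trunc_val_unif hv hpi).
  have hx : val_ge v (r./2.+1)%:Z (pi ^+ (r - i)).
    by apply: val_geW (unifX_ge hv hpi _) _; lia.
  have [h hn] := nilp_coord_z hx.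
  exists (pi ^+ (r - i)), (- (pi ^+ (r - i) * pi ^+ (r - i)) / pi ^+ r), 1; split=> //.
  case: asboolP => // _; rewrite (trunc_val_unif hv hpi); lia.
Qed.

Lemma classified_sub2 : (0 < r)%N ->
  classified (opt_nilpotent v E0) (conj_unit_rel v G2) r.+2./2.
Proof.
move=> r0.
have lo x y z : good x y z -> (uphalf r <= trunc_val v r x)%N.
  move=> h; rewrite (trunc_val_geP (nilp_coord_O h)); last by lia.
  exact: (nilp_coord_ge hv hpi h).
(* The truncated valuation takes the [r/2] + 1 values from [uphalf r] to r. *)
apply: (@classified_good _ _ (fun x y => trunc_val v r x - uphalf r)%N).
- move=> x y z x' y' z' h h'; apply: (iff_trans (conj_unit_rel_normalizer0P r0 h h')).
  by have := lo _ _ _ h; have := lo _ _ _ h'; split; lia.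
- move=> x y z h; have := lo _ _ _ h; have := trunc_val_le v r x; lia.
- move=> i hi; exists (pi ^+ (i + uphalf r)), 1.
  exists (- (pi ^+ (i + uphalf r) * pi ^+ (i + uphalf r)) / pi ^+ r); split.
    by apply: nilp_coord_y; apply: val_geW (unifX_ge hv hpi _) _; lia.
  by rewrite (trunc_val_unif hv hpi) ?addnK //; lia.
Qed.

Lemma conj_rel_normalizer_goodP x y z x' y' z' :
  (0 < r)%N -> good x y z -> good x' y' z' ->
  conj_rel G2 (nil0 x y z) (nil0 x' y' z') <->
  (val_ge v r%:Z (x - x') /\ (val_unit v y <-> val_unit v y')) \/
  (val_ge v r%:Z (- x - x') /\ (val_unit v z <-> val_unit v y')).
Proof.
move=> r0 h h'; apply: (iff_trans (conj_rel_normalizer0P hv hpi _ _ _)).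
rewrite (conj_atkin_nil0 hpi).
have h1 := conj_rel0P hv hpi r0 h h'.
have h2 := conj_rel0P hv hpi r0 (nilp_coord_atkin hv h) h'.
by split=> -[/h1|/h2]; by [left|right].
Qed.

(** At level 0 the congruences are void and w lies in Gamma_1, so y and z may be exchanged in either
    matrix until both have a unit in the same place. *)
Lemma conj_rel_level0 n n' : r = 0%N -> opt_nilpotent v E0 n ->
  opt_nilpotent v E0 n' -> conj_rel G1 n n'.
Proof.
move=> r0 /(opt_nilpotent0P hv hpi) [x [y [z [-> h]]]].
move=> /(opt_nilpotent0P hv hpi) [x' [y' [z' [-> h']]]].
have small t t' : O t -> O t' -> val_ge v r%:Z (t - t').
  by rewrite r0; apply: val_geB.
have wG : G1 atkin.
  apply/(scalar_units0P hv hpi); exists 1, 0, 1, 1, 0.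
  rewrite oner_neq0 scale1r !mulr1; split=> //.
    by split; try exact: val_ge_1; left.
  rewrite mul0r sub0r r0 expr0; split; first by rewrite oppr_eq0 oner_neq0.
  by rewrite (valuationN hv) valuation1.
have hxx := small _ _ (nilp_coord_O h) (nilp_coord_O h').
have [hy|hy] := pselect (val_unit v y); have [hy'|hy'] := pselect (val_unit v y').
- exact: conj_rel_unit_y.
- have hz' := nilp_coord_unit h' hy'.
  have [g gG gn] : conj_rel G1 (nil0 x y z) (nil0 (- x') z' y').
    apply: conj_rel_unit_y => //; first exact: nilp_coord_atkin.
    by apply: small; [exact: nilp_coord_O h|rewrite (val_geN hv); exact: nilp_coord_O h'].
  have [Gu _ GM _] := scalar_units0_group hv r.
  exists (atkin * g); first exact: GM.
  by rewrite conj_byM; [rewrite gn (conj_atkin_nil0 hpi) opprK|exact: Gu|exact: Gu].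
- have hz := nilp_coord_unit h hy.
  have [g gG gn] : conj_rel G1 (nil0 (- x) z y) (nil0 x' y' z').
    apply: conj_rel_unit_y => //; first exact: nilp_coord_atkin.
    by apply: small; [rewrite (val_geN hv); exact: nilp_coord_O h|exact: nilp_coord_O h'].
  have [Gu _ GM _] := scalar_units0_group hv r.
  exists (g * atkin); first exact: GM.
  by rewrite conj_byM; [rewrite (conj_atkin_nil0 hpi) gn|exact: Gu|exact: Gu].
- by apply: conj_rel_unit_z => //; [exact: nilp_coord_unit h hy|exact: (nilp_coord_unit h' hy')].
Qed.

Lemma classified_level0 (R : 'M[k]_2 -> 'M[k]_2 -> Prop) : r = 0%N ->
  (forall n n', conj_rel G1 n n' -> R n n') -> classified (opt_nilpotent v E0) R 1.
Proof.
move=> r0 GR; exists (fun=> 0%N); split=> // [n n' Xn Xn'|[|//] _].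
  by split=> // _; apply: GR; apply: conj_rel_level0.
exists (nil0 0 1 0) => //; apply/(opt_nilpotent0P hv hpi); exists 0, 1, 0.
split=> //; split; try by left.
- by ring.
- exact: val_ge_1.
- by left; apply: val_unit1.
Qed.

Variable p : nat.
Hypothesis hp : residue_field v #= `I_p.

Lemma classified_emb1 : (0 < r)%N ->
  classified (opt_nilpotent v E0) (conj_rel G1) (p ^ r./2 + p ^ r.-1./2).
Proof.
move=> r0.
(* [d] codes x modulo pi^r when y is a unit and [e] when it is not; the codes of the second family
   are shifted by p^[r/2] to be disjoint from the first. *)
have [d dP [dlt ds]] := ideal_code hv hpi hp (uphalf r) r./2.
have [e eP [elt es]] := ideal_code hv hpi hp r./2.+1 r.-1./2.
have dr : (uphalf r + r./2)%N = r by lia.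
have er : (r./2.+1 + r.-1./2)%N = r by lia.
rewrite dr in dP; rewrite er in eP.
apply: (@classified_good _ _
  (fun x y => if `[< val_unit v y >] then d x else (p ^ r./2 + e x)%N)).
- move=> x y z x' y' z' h h'.
  have hx := nilp_coord_ge hv hpi h; have hx' := nilp_coord_ge hv hpi h'.
  apply: (iff_trans (conj_rel0P hv hpi r0 h h')).
  case: asboolP => hy; case: asboolP => hy'.
  + by rewrite dP //; tauto.
  + by have := dlt _ hx; split; [tauto|lia].
  + by have := dlt _ hx'; split; [tauto|lia].
  + have {}hx : val_ge v (r./2.+1)%:Z x by apply: (nilp_coord_ge_gt hv hpi h _) => // -[].
    have {}hx' : val_ge v (r./2.+1)%:Z x' by apply: (nilp_coord_ge_gt hv hpi h' _) => // -[].
    split=> [[hxx _]|/addnI/eP]; first by congr (_ + _)%N; apply/eP.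
    by move=> hxx; split; [exact: hxx|tauto].
- move=> x y z h; case: asboolP => hy.
    by have := dlt _ (nilp_coord_ge hv hpi h); lia.
  by rewrite ltn_add2l; apply: elt; apply: (nilp_coord_ge_gt hv hpi h _) => // -[].
- move=> i hi; case: (ltnP i (p ^ r./2)) => [/ds [x hx <-]|hi'].
    have h := nilp_coord_y hx.
    by exists x, 1, (- (x * x) / pi ^+ r); split=> //; case: asboolP => // -[]; apply: val_unit1.
  have [|x hx hex] := es (i - p ^ r./2)%N; first by lia.
  have [h hn] := nilp_coord_z hx.
  exists x, (- (x * x) / pi ^+ r), 1; split=> //; case: asboolP => // _.
  by rewrite hex subnKC.
Qed.

(** Applying w when y is not a unit makes y a unit and turns x into -x; the code is the resulting x
    modulo pi^r. Where y and z are both units w changes x to -x within this family, and the code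
    survives because 2x lies in pi^(r/2) pi^(r/2) O. *)
Lemma classified_emb2_even : (0 < r)%N -> ~~ odd r -> val_ge v r./2%:Z 2%:R ->
  classified (opt_nilpotent v E0) (conj_rel G2) (p ^ r./2).
Proof.
move=> r0 rodd h2.
have [d dP [dlt ds]] := ideal_code hv hpi hp (uphalf r) r./2.
have dr : (uphalf r + r./2)%N = r by lia.
rewrite dr in dP.
pose s (x y : k) := if `[< val_unit v y >] then x else - x.
have hs x y z : good x y z -> val_ge v (uphalf r)%:Z (s x y).
  by move=> h; rewrite /s; case: ifP => _; rewrite ?(val_geN hv); apply: (nilp_coord_ge hv hpi h).
apply: (@classified_good _ _ (fun x y => d (s x y))).
- move=> x y z x' y' z' h h'; rewrite dP; [|exact: hs h|exact: hs h'].
  apply: (iff_trans (conj_rel_normalizer_goodP r0 h h')); rewrite /s.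
  have opp t t' : val_ge v r%:Z (- t - t') <-> val_ge v r%:Z (t - - t').
    by rewrite -(val_geN hv) opprD !opprK.
  case: asboolP => hy; case: asboolP => hy'.
  + split=> [[[]//|[hx _]]|hx]; last by left.
    (* Here 2 and x each contribute r/2 to the valuation of 2x. *)
    rewrite (_ : x - x' = 2%:R * x + (- x - x')); last by ring.
    apply: val_geD => //; have := val_geM hv h2 (nilp_coord_ge hv hpi h).
    by move=> hh; apply: val_geW hh _; lia.
  + rewrite opp; split=> [[|[]//]|hx]; first by tauto.
    right; split=> //; split=> // hz; exfalso.
    apply: (nilp_coord_lt_not_both h _ hy hz); rewrite -[x](subrK (- x')).
    apply: val_geD => //; first by apply: val_geW hx _; lia.
    by rewrite (val_geN hv); apply: (nilp_coord_ge_gt hv hpi h' _) => // -[].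
  + split=> [[|[]//]|hx]; first by tauto.
    by right; split=> //; split=> // _; apply: (nilp_coord_unit h hy).
  + have nn : val_ge v r%:Z (- x - - x') <-> val_ge v r%:Z (x - x').
      by rewrite -opprD (val_geN hv).
    rewrite nn; split=> [[[]//|[_ hz]]|hx]; last by left; split=> //; tauto.
    by exfalso; apply: hy'; apply/hz; apply: (nilp_coord_unit h hy).
- by move=> x y z h; apply: dlt; exact: (hs _ _ _ h).
- move=> i /ds [x hx <-]; have h := nilp_coord_y hx.
  exists x, 1, (- (x * x) / pi ^+ r); split=> //; rewrite /s.
  by case: asboolP => // -[]; apply: val_unit1.
Qed.

Lemma classified_emb2_free : (0 < r)%N -> ~ (~~ odd r /\ val_ge v r./2%:Z 2%:R) ->
  exists2 e, (p ^ r./2 + p ^ r.-1./2)%N = e.*2 &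
    classified (opt_nilpotent v E0) (conj_rel G2) e.
Proof.
move=> r0 hn.
apply: (classified_involution (s := conj_by atkin) (classified_emb1 r0)).
- exact: opt_nilpotent0_atkin.
- by move=> n _; apply: conj_atkinK.
- by move=> n n' _ _; apply: conj_rel_atkin.
- move=> n /(opt_nilpotent0P hv hpi) [x [y [z [-> h]]]]; rewrite (conj_atkin_nil0 hpi).
  move=> /(conj_rel0P hv hpi r0 (nilp_coord_atkin hv h) h) [hx hyz].
  have hy : val_unit v y.
    apply: contrapT => hy; apply: (hy); apply/hyz.
    exact: (nilp_coord_unit h hy).
  have [x0 vx] := nilp_coord_both_units hv hpi h hy (proj2 hyz hy).
  apply: hn; split; first by lia.
  move: hx; rewrite (_ : - x - x = (- x) * 2%:R); last by ring.
  rewrite (val_geZ hv) ?oppr_eq0 // (valuationN hv) => hx.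
  by apply: val_geW hx _; lia.
- by move=> n n' _ _; apply: conj_rel_normalizer0P.
Qed.

End Counting.

(** * Embeddings and suborders *)

Section DualNumbers.
Variables (k : fieldType) (A : algType k) (n : A).
Hypotheses (n0 : n != 0) (nn : n * n = 0).

Lemma dual_numbers_mul a b a' b' : (a *: 1 + b *: n) * (a' *: 1 + b' *: n) =
  (a * a') *: 1 + (a * b' + b * a') *: n.
Proof.
rewrite mulrDl !mulrDr -!scalerAl -!scalerAr nn !(mul1r, mulr1, scaler0, addr0).
by rewrite !scalerA scalerDl addrA.
Qed.

(** Multiplication by n kills the n-part and leaves (a - a') n = 0. *)
Lemma dual_numbers_inj a b a' b' :
  a *: 1 + b *: n = a' *: 1 + b' *: n -> a = a' /\ b = b'.
Proof.
move=> h; have aa : a = a'.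
  have := congr1 (fun t => t * n) h.
  rewrite /= !mulrDl -!scalerAl nn mul1r !scaler0 !addr0 => /eqP.
  by rewrite -subr_eq0 -scalerBl scaler_eq0 (negPf n0) orbF subr_eq0 => /eqP.
split=> //; move: h; rewrite aa => /addrI/eqP.
by rewrite -subr_eq0 -scalerBl scaler_eq0 (negPf n0) orbF subr_eq0 => /eqP.
Qed.
End DualNumbers.

(** * Transport along conjugation by a fixed matrix *)

Section Transport.
Variables (k : fieldType) (v : k -> int).
Local Notation O := (val_ge v 0).
Variables (E : set 'M[k]_2) (h : 'M[k]_2).
Hypothesis hu : h \is a GRing.unit.
Local Notation E' := (conj_by h @` E).

Lemma unit_group_conj u : unit_group E u -> unit_group E' (conj_by h u).
Proof.
move=> [uE [u' [u'E e1 e2]]]; split; first by exists u.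
exists (conj_by h u'); split; first by exists u'.
  by rewrite -conj_by_mul // e1 conj_by_unit.
by rewrite -conj_by_mul // e2 conj_by_unit.
Qed.

Lemma scalar_units_conj g : scalar_units E g -> scalar_units E' (conj_by h g).
Proof.
move=> [a [u [a0 uE ->]]]; exists a, (conj_by h u).
by rewrite conj_byZ; split=> //; apply: unit_group_conj.
Qed.

Lemma order_normalizer_conj g : order_normalizer E g -> order_normalizer E' (conj_by h g).
Proof.
move=> [gu gE]; split; first by rewrite /conj_by !unitrMr ?unitrV.
rewrite image_comp -[in RHS]gE image_comp; apply: eq_imagel => n _ /=.
rewrite -!conj_byM //; last by rewrite /conj_by !unitrMr ?unitrV.
by rewrite {1}/conj_by mulrVK.
Qed.

Lemma opt_nilpotent_conj n : opt_nilpotent v E n -> opt_nilpotent v E' (conj_by h n).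
Proof.
move=> [n0 nn nE]; split.
- apply/eqP => h0; move: n0; rewrite -[n](conj_byK _ hu) h0 /conj_by.
  by rewrite mulr0 mul0r eqxx.
- by rewrite -conj_by_mul // nn conj_by0.
- by move=> y; rewrite -nE -conj_byZ conj_by_imageE // conj_byK.
Qed.

End Transport.

Section TransportClassified.
Variables (k : fieldType) (v : k -> int).
Implicit Types (E : set 'M[k]_2) (h n : 'M[k]_2).

Lemma conj_image_back E h : h \is a GRing.unit -> conj_by h^-1 @` (conj_by h @` E) = E.
Proof.
move=> hu; rewrite image_comp -[RHS]image_id; apply: eq_imagel => n _ /=.
by rewrite conj_byK.
Qed.

Lemma conj_rel_conj (G G' : set 'M[k]_2) h n n' : h \is a GRing.unit ->
  (forall g, G g -> g \is a GRing.unit) ->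
  (forall g, G g -> G' (conj_by h g)) -> conj_rel G n n' ->
  conj_rel G' (conj_by h n) (conj_by h n').
Proof.
move=> hu Gu GG' [g gG <-]; exists (conj_by h g); first exact: GG'.
have gu := Gu _ gG.
rewrite -!conj_byM //; last by rewrite /conj_by !unitrMr ?unitrV.
by rewrite {1}/conj_by mulrVK.
Qed.

Lemma classified_bij (T : Type) (X X' : set T) (R R' : T -> T -> Prop)
    (s t : T -> T) e : cancel s t -> cancel t s ->
  (forall x, X x -> X' (s x)) -> (forall x, X' x -> X (t x)) ->
  (forall x y, R' x y <-> R (t x) (t y)) -> classified X R e -> classified X' R' e.
Proof.
move=> st ts Xs Xt RR [f [fR fe fs]]; exists (f \o t); split.
- move=> n n' Xn Xn'; apply: (iff_trans (RR _ _)); apply: fR; exact: Xt.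
- by move=> n Xn; apply/fe/Xt.
- by move=> i /fs [n Xn fn]; exists (s n); [apply: Xs|rewrite /= st].
Qed.

(** [F] stands for either construction of a group from an order, k^* E^* or the normaliser. Both
    commute with conjugation, which carries the counts for the standard order over to E. *)
Lemma classified_conj (F : set 'M[k]_2 -> set 'M[k]_2) E h e : h \is a GRing.unit ->
  (forall E1 g, F E1 g -> g \is a GRing.unit) ->
  (forall E1 h1 g, h1 \is a GRing.unit -> F E1 g ->
     F (conj_by h1 @` E1) (conj_by h1 g)) ->
  (classified (opt_nilpotent v E) (conj_rel (F E)) e ->
   classified (opt_nilpotent v (conj_by h @` E)) (conj_rel (F (conj_by h @` E))) e) /\
  (classified (opt_nilpotent v E) (conj_unit_rel v (F E)) e ->
   classified (opt_nilpotent v (conj_by h @` E))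
     (conj_unit_rel v (F (conj_by h @` E))) e).
Proof.
move=> hu Fu Fc.
have hi : h^-1 \is a GRing.unit by rewrite unitrV.
have back := conj_image_back E hu.
have Xback n : opt_nilpotent v (conj_by h @` E) n -> opt_nilpotent v E (conj_by h^-1 n).
  by move=> /(opt_nilpotent_conj hi); rewrite back.
have relE n n' : conj_rel (F (conj_by h @` E)) n n' <->
    conj_rel (F E) (conj_by h^-1 n) (conj_by h^-1 n').
  split=> [|hr].
    apply: conj_rel_conj => // g gF; first exact: Fu gF.
    by rewrite -[in F E]back; apply: Fc.
  rewrite -[n](conj_byVK _ hu) -[n'](conj_byVK _ hu).
  apply: (conj_rel_conj hu _ _ hr) => g gF; first exact: Fu gF.
  exact: Fc.
split; apply: (classified_bij (s := conj_by h) (t := conj_by h^-1)).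
- by move=> n; rewrite conj_byK.
- by move=> n; rewrite conj_byVK.
- by move=> n; apply: opt_nilpotent_conj.
- exact: Xback.
- exact: relE.
- by move=> n; rewrite conj_byK.
- by move=> n; rewrite conj_byVK.
- by move=> n; apply: opt_nilpotent_conj.
- exact: Xback.
- move=> n n'; split=> -[u uu hr]; exists u => //.
    by move: hr => /relE; rewrite conj_byZ.
  by apply/relE; rewrite conj_byZ.
Qed.
End TransportClassified.

(** What the passage from embeddings and suborders to nilpotent matrices needs of E; the
    determinants serve to bound the scalar part of a + b n. *)
Definition good_order (k : fieldType) (v : k -> int) (E : set 'M[k]_2) : Prop :=
  [/\ E 1, forall a m n, val_ge v 0 a -> E m -> E n -> E (a *: m + n),
      forall m n, E m -> E n -> E (m * n) & forall m, E m -> val_ge v 0 (\det m)].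

Lemma good_order_conj (k : fieldType) (v : k -> int) (E : set 'M[k]_2) (h : 'M[k]_2) :
  h \is a GRing.unit -> good_order v E -> good_order v (conj_by h @` E).
Proof.
move=> hu [E1 El EM Ed]; split.
- by exists 1 => //; rewrite conj_by_unit.
- move=> a _ _ aO [m mE <-] [n nE <-]; exists (a *: m + n); first exact: El.
  by rewrite conj_byD conj_byZ.
- by move=> _ _ [m mE <-] [n nE <-]; exists (m * n); [apply: EM|rewrite conj_by_mul].
- by move=> _ [m mE <-]; rewrite det_conj_by //; apply: Ed.
Qed.

(** * From embeddings and suborders to nilpotent matrices *)

Section Embeddings.
Variables (k : fieldType) (v : k -> int).
Hypothesis hv : discrete_valuation v.
Local Notation O := (val_ge v 0).
Variables (L : algType k) (c : L).
Hypotheses (c0 : c != 0) (cc : c * c = 0).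
Local Notation H := (adjoin_integers v c).
Hypothesis hL : span_over setT H = setT.

Lemma horner_alg_dual q : horner_alg c q = q`_0 *: 1 + q`_1 *: c.
Proof.
elim/poly_ind: q => [|q a IH]; first by rewrite rmorph0 !coef0 !scale0r addr0.
rewrite rmorphD rmorphM /= horner_algX horner_algC IH !coefD !coefMX !coefC /=.
rewrite mulrDl -!scalerAl cc scaler0 mul1r !(addr0, add0r).
by rewrite addrC.
Qed.

Lemma adjoin_dualP l :
  H l <-> exists a b, [/\ O a, O b & l = a *: 1 + b *: c].
Proof.
split=> [[q qO <-]|[a [b [aO bO ->]]]].
  by exists q`_0, q`_1; rewrite horner_alg_dual; split=> //; apply: qO.
exists (b%:P * 'X + a%:P); last by rewrite horner_alg_dual !coefD !coefMX !coefC /= !(addr0, add0r).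
move=> i; rewrite /= coefD coefMX !coefC.
by case: i => [|[|i]] /=; rewrite ?addr0 ?add0r //; left.
Qed.

Lemma dual_coord l : exists a b, l = a *: 1 + b *: c.
Proof.
have : span_over setT H l by rewrite hL.
move=> [n [a [s [_ sH ->]]]].
elim/big_ind: _ => [|x y [a1 [b1 ->]] [a2 [b2 ->]]|i _].
- by exists 0, 0; rewrite !scale0r addr0.
- by exists (a1 + a2), (b1 + b2); rewrite !scalerDl addrACA.
- have /adjoin_dualP [x [y [_ _ ->]]] := sH i.
  by exists (a i * x), (a i * y); rewrite scalerDr !scalerA.
Qed.

Lemma adjoin_dualE a b : H (a *: 1 + b *: c) <-> O a /\ O b.
Proof.
split=> [/adjoin_dualP [x [y [xO yO /(dual_numbers_inj c0 cc) [-> ->]]]] //|[aO bO]].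
by apply/adjoin_dualP; exists a, b.
Qed.

(** As H spans L, the elements 1 and c form a basis of L; the linear map sending c to n is
    multiplicative because both squares vanish. *)
Lemma dual_embedding (n : 'M[k]_2) : n != 0 -> n * n = 0 ->
  exists2 phi : {lrmorphism L -> 'M[k]_2}, injective phi &
    forall a b, phi (a *: 1 + b *: c) = a *: 1 + b *: n.
Proof.
move=> n0 nn.
have /choice [ab abP] : forall l, exists ab : k * k, l = ab.1 *: 1 + ab.2 *: c.
  by move=> l; have [a [b e]] := dual_coord l; exists (a, b).
pose f (l : L) : 'M[k]_2 := (ab l).1 *: 1 + (ab l).2 *: n.
have fE a b : f (a *: 1 + b *: c) = a *: 1 + b *: n.
  by have := abP (a *: 1 + b *: c); rewrite /f => /(dual_numbers_inj c0 cc) [<- <-].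
have lin : linear f.
  move=> t x y; have [a [b ->]] := dual_coord x; have [a' [b' ->]] := dual_coord y.
  by rewrite scalerDr !scalerA addrACA -!scalerDl !fE scalerDr !scalerA addrACA -!scalerDl.
have mon : GRing.monoid_morphism f.
  split; last first.
    move=> x y; have [a [b ->]] := dual_coord x; have [a' [b' ->]] := dual_coord y.
    by rewrite (dual_numbers_mul cc) !fE (dual_numbers_mul nn).
  by have := fE 1 0; rewrite !scale0r !scale1r !addr0.
pose phi : {lrmorphism L -> 'M[k]_2} := HB.pack f
  (GRing.isLinear.Build k L 'M[k]_2 _ f lin)
  (GRing.isMonoidMorphism.Build L 'M[k]_2 f mon).
exists phi; last exact: fE.
move=> x y; have [a [b ->]] := dual_coord x; have [a' [b' ->]] := dual_coord y.
by rewrite /= !fE => /(dual_numbers_inj n0 nn) [-> ->].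
Qed.

Variable E : set 'M[k]_2.
Hypothesis hE : good_order v E.

(** Trace and determinant of n vanish, so det(a + b n) = a^2 and a is integral. Then b n lies in E
    and the optimality of n applies to b. *)
Lemma opt_nilpotentP n a b :
  opt_nilpotent v E n -> E (a *: 1 + b *: n) <-> O a /\ O b.
Proof.
case: hE => E1 El _ Ed [n0 nn nE]; split=> [h|[aO bO]]; last by apply: El => //; apply/nE.
have aO : O a.
  have [x [y [z [nE' hx]]]] := nilpotent_mx2P n0 nn.
  have := Ed _ h; rewrite nE' mx2_1 !mx2Z mx2D det_mx2.
  rewrite (_ : _ - _ = a * a - b * b * (x * x + y * z)); last by ring.
  by rewrite hx mulr0 subr0 => h'; apply: (val_ge_sqr hv h').
split=> //; apply/nE.
have -> : b *: n = (- a) *: 1 + (a *: 1 + b *: n) by rewrite addrA scaleNr addNr add0r.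
by apply: El => //; rewrite (val_geN hv).
Qed.

Local Notation X := (optimal_embeddings H E).

Lemma optimal_embedding_nilpotent phi : X phi -> opt_nilpotent v E (phi c).
Proof.
move=> [f [fi fE] <-]; split.
- by rewrite -(rmorph0 f); apply/eqP => /fi /eqP; rewrite (negPf c0).
- by rewrite -rmorphM cc rmorph0.
- move=> y; rewrite -linearZ -[y *: c]add0r -(scale0r 1).
  have -> : E (f (0 *: 1 + y *: c)) = (f @^-1` E) (0 *: 1 + y *: c) by [].
  by rewrite fE adjoin_dualE; split=> [[]|]//; split=> //; left.
Qed.

Lemma optimal_embedding_exists n : opt_nilpotent v E n -> exists2 phi, X phi & phi c = n.
Proof.
move=> hn; have [n0 nn _] := hn; have [phi phii phiE] := dual_embedding n0 nn.
exists phi; last by have := phiE 0 1; rewrite !scale0r !scale1r !add0r.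
exists phi => //; split=> //; apply/seteqP; split=> l /=;
  have [a [b ->]] := dual_coord l; rewrite phiE.
- by move=> /(opt_nilpotentP _ _ hn) /adjoin_dualE.
- by move=> /adjoin_dualE /(opt_nilpotentP _ _ hn).
Qed.

Lemma optimal_embeddingE phi a b : X phi ->
  phi (a *: 1 + b *: c) = a *: 1 + b *: phi c.
Proof. by move=> [f _ <-]; rewrite linearD !linearZ /= rmorph1. Qed.

(** An embedding is determined by the image of c, so the classification transfers along phi |-> phi
    c. *)
Lemma embedding_orbits_card (G : set 'M[k]_2) e : conj_group G ->
  classified (opt_nilpotent v E) (conj_rel G) e -> embedding_orbits X G #= `I_e.
Proof.
move=> [Gu G1 GM GV] hcl.
have {hcl} : classified X (fun phi psi => conj_rel G (phi c) (psi c)) e.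
  have [f [fR fe fs]] := hcl; exists (fun phi => f (phi c)); split.
  - by move=> phi psi /optimal_embedding_nilpotent h1 /optimal_embedding_nilpotent h2; apply: fR.
  - by move=> phi /optimal_embedding_nilpotent; apply: fe.
  - by move=> i /fs [n /optimal_embedding_exists [phi Xphi <-] <-]; exists phi.
apply: classified_card => phi psi Xphi Xpsi; split.
  have : [set conj_by g \o psi | g in G] psi.
    by exists 1 => //; apply/funext => l; rewrite /= conj_by1.
  by move=> + e0; rewrite -e0 => -[g gG <-]; exists g.
move=> [g gG gc].
have -> : psi = conj_by g \o phi.
  apply/funext => l /=; have [a [b ->]] := dual_coord l.
  rewrite !optimal_embeddingE // conj_byD !conj_byZ gc conj_by_unit //; exact: Gu.
apply/seteqP; split=> _ [x xG <-].
  exists (x * g^-1); first by apply: GM => //; apply: GV.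
  apply/funext => l /=; rewrite -conj_byM ?mulrVK //.
  - exact: Gu.
  - by apply: Gu; apply: GM => //; apply: GV.
  - exact: Gu.
exists (x * g); first exact: GM.
by apply/funext => l /=; rewrite conj_byM //; apply: Gu.
Qed.

Local Notation Y := (optimal_suborders v H E).

Definition nil_order (n : 'M[k]_2) : set 'M[k]_2 :=
  [set m | exists a b, [/\ O a, O b & m = a *: 1 + b *: n]].

Lemma nil_orderE n a b : n != 0 -> n * n = 0 ->
  nil_order n (a *: 1 + b *: n) <-> O a /\ O b.
Proof.
move=> n0 nn; split=> [[x [y [xO yO /(dual_numbers_inj n0 nn) [-> ->]]]]//|[aO bO]].
by exists a, b.
Qed.

Lemma nil_order_is_order n : n * n = 0 -> is_order v (nil_order n).
Proof.
move=> nn; split.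
- by exists 1, 0; rewrite scale1r scale0r addr0; split=> //; [apply: val_ge_1|left].
- move=> _ _ [a [b [aO bO ->]]] [a' [b' [a'O b'O ->]]].
  exists (a * a'), (a * b' + b * a'); rewrite (dual_numbers_mul nn); split=> //.
    exact: val_geMl.
  by apply: val_geD => //; apply: val_geMl.
- exists 2%N, (fun i : 'I_2 => if i == 0 then 1 else n).
  apply/seteqP; split=> [_ [a [b [aO bO ->]]]|m].
    exists 2%N, (fun i => if i == 0 then a else b), (fun i => if i == 0 then 1 else n).
    split; first by move=> i; case: ifP.
      by move=> i; exists i.
    by rewrite !big_ord_recl big_ord0 addr0.
  move=> [q [a [s [aO sH ->]]]].
  elim/big_ind: _ => [|x y [a1 [b1 [? ? ->]]] [a2 [b2 [? ? ->]]]|i _].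
  + by exists 0, 0; rewrite !scale0r addr0; split=> //; left.
  + exists (a1 + a2), (b1 + b2); rewrite !scalerDl addrACA.
    by split=> //; apply: val_geD.
  + have [j _ <-] := sH i; case: ifP => _.
      by exists (a i), 0; rewrite scale0r addr0; split=> //; [exact: aO|left].
    by exists 0, (a i); rewrite scale0r add0r; split=> //; [left|exact: aO].
Qed.

Lemma nil_order_span n m : span_over setT (nil_order n) m ->
  exists a b, m = a *: 1 + b *: n.
Proof.
move=> [q [a [s [_ sH ->]]]].
elim/big_ind: _ => [|x y [a1 [b1 ->]] [a2 [b2 ->]]|i _].
- by exists 0, 0; rewrite !scale0r addr0.
- by exists (a1 + a2), (b1 + b2); rewrite !scalerDl addrACA.
- have [x [y [_ _ ->]]] := sH i.
  by exists (a i * x), (a i * y); rewrite scalerDr !scalerA.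
Qed.

Lemma span_over_sub (S : set 'M[k]_2) : S `<=` span_over setT S.
Proof.
move=> m mS; exists 1%N, (fun=> 1), (fun=> m); split=> //.
by rewrite big_ord_recl big_ord0 addr0 scale1r.
Qed.

Lemma nil_order_suborder n : opt_nilpotent v E n -> Y (nil_order n).
Proof.
move=> hn; have [n0 nn _] := hn; have nE a b := opt_nilpotentP a b hn.
have sub : nil_order n `<=` E by move=> _ [a [b [aO bO ->]]]; apply/nE.
split=> //.
- exact: nil_order_is_order.
- apply/seteqP; split=> m; last by move=> hm; split; [apply: span_over_sub|apply: sub].
  by move=> [/nil_order_span [a [b ->]] /nE [aO bO]]; exists a, b.
- have [phi phii phiE] := dual_embedding n0 nn; exists phi; split.
  + split.
    * by move=> _ /adjoin_dualP [a [b [aO bO ->]]]; rewrite phiE; exists a, b.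
    * by move=> x y _ _; apply: phii.
    * move=> _ [a [b [aO bO ->]]]; exists (a *: 1 + b *: c); last exact: phiE.
      by apply/adjoin_dualE.
  + by move=> a x y _ _ _; rewrite linearP.
  + exact: rmorph1.
  + by move=> x y _ _; rewrite rmorphM.
Qed.

(** The generator is the image of c. The isomorphism is linear only over O and only on H, so its
    values are recomputed from those at 1 and c; kS ∩ E = S then yields the optimality of the
    generator. *)
Lemma suborder_nil_order S : Y S -> exists2 n, opt_nilpotent v E n & S = nil_order n.
Proof.
move=> [_ SE spanS [f [[fS fi fs] flin f1 fM]]].
have Hab a b : O a -> O b -> H (a *: 1 + b *: c) by move=> aO bO; apply/adjoin_dualE.
have O0 : O 0 by left.
have O1 : O 1 by apply: val_ge_1.
have H0 : H 0 by have := Hab 0 0 O0 O0; rewrite !scale0r addr0.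
have H1 : H 1 by have := Hab 1 0 O1 O0; rewrite scale1r scale0r addr0.
have Hc : H c by have := Hab 0 1 O0 O1; rewrite scale1r scale0r add0r.
have f0 : f 0 = 0.
  have := flin 1 0 0 O1 H0 H0; rewrite scale1r addr0 => /eqP.
  by rewrite scale1r -{1}[f 0]addr0 (inj_eq (addrI _)) eq_sym => /eqP.
have fE a b : O a -> O b -> f (a *: 1 + b *: c) = a *: 1 + b *: f c.
  move=> aO bO; have hb : H (b *: c) by have := Hab 0 b O0 bO; rewrite scale0r add0r.
  rewrite flin // f1; congr (_ + _).
  by rewrite -[b *: c]addr0 flin // f0 addr0.
have SnE : S = nil_order (f c).
  apply/seteqP; split=> [m /fs [_ /adjoin_dualP [a [b [aO bO ->]]] <-]|_ [a [b [aO bO ->]]]].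
    by rewrite fE //; exists a, b.
  by rewrite -fE //; apply: fS; apply: Hab.
have n0 : f c != 0.
  by rewrite -f0; apply/eqP => /fi; rewrite !inE => /(_ Hc H0) /eqP; rewrite (negPf c0).
have nn : f c * f c = 0 by rewrite -fM // cc f0.
exists (f c) => //; split=> // y; split.
  move=> hy; have : S (y *: f c).
    rewrite -spanS; split=> //; exists 1%N, (fun=> y), (fun=> f c); split=> //.
      by move=> _; apply: fS.
    by rewrite big_ord_recl big_ord0 addr0.
  by rewrite SnE -[y *: _]add0r -(scale0r 1) nil_orderE // => -[].
move=> yO; apply: SE; rewrite SnE -[y *: _]add0r -(scale0r 1) nil_orderE //.
Qed.

Lemma conj_nil_order g n : g \is a GRing.unit ->
  conj_by g @` nil_order n = nil_order (conj_by g n).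
Proof.
move=> gu; apply/seteqP; split=> [_ [_ [a [b [aO bO ->]]] <-]|_ [a [b [aO bO ->]]]].
  by exists a, b; rewrite conj_byD !conj_byZ conj_by_unit.
exists (a *: 1 + b *: n); first by exists a, b.
by rewrite conj_byD !conj_byZ conj_by_unit.
Qed.

(** The nilpotent elements of O[n'] are the multiples of n', since (a + b n')^2 = 0 forces a = 0.
    Two generators are therefore integral multiples of each other, with factors whose product is
    1. *)
Lemma nil_order_eqP n n' : n != 0 -> n * n = 0 -> n' != 0 -> n' * n' = 0 ->
  nil_order n = nil_order n' <-> exists2 u, val_unit v u & n = u *: n'.
Proof.
move=> n0 nn n'0 n'n'; have O0 : O 0 by left.
have O1 : O 1 by apply: val_ge_1.
have mem x y : x != 0 -> x * x = 0 -> y != 0 -> y * y = 0 ->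
    nil_order x = nil_order y -> exists2 u, O u & x = u *: y.
  move=> x0 xx y0 yy e.
  have : nil_order y x.
    by rewrite -e; exists 0, 1; rewrite scale0r scale1r add0r.
  move=> [a [b [aO bO xE]]]; exists b => //.
  suff a0 : a = 0 by rewrite xE a0 scale0r add0r.
  have : a * a = 0.
    have h : (a * a) *: 1 + (a * b + b * a) *: y = 0 *: 1 + 0 *: y.
      by rewrite -(dual_numbers_mul yy) -xE xx !scale0r addr0.
    by have [] := dual_numbers_inj y0 yy h.
  by move=> /eqP; rewrite mulf_eq0 orbb => /eqP.
split=> [e|[u hu ->]].
  have [u uO nE] := mem _ _ n0 nn n'0 n'n' e.
  have [w wO n'E] := mem _ _ n'0 n'n' n0 nn (esym e).
  exists u => //; have /eqP : (u * w - 1) *: n = 0.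
    by rewrite scalerBl -scalerA -n'E -nE scale1r subrr.
  rewrite scaler_eq0 (negPf n0) orbF subr_eq0 => /eqP uw.
  have u0 : u != 0 by apply/eqP => u0; move/eqP: uw; rewrite u0 mul0r eq_sym oner_eq0.
  have w0 : w != 0 by apply/eqP => w0; move/eqP: uw; rewrite w0 mulr0 eq_sym oner_eq0.
  have vuw : v u + v w = 0 by rewrite -(valuationM hv) // uw (valuation1 hv).
  by move: uO wO; rewrite !val_geE // => ? ?; split=> //; lia.
have uO := val_unit_ge hu; have wO := val_unit_ge (val_unitV hv hu).
have u0 := proj1 hu.
apply/seteqP; split=> _ [a [b [aO bO ->]]].
  by exists a, (b * u); rewrite scalerA; split=> //; apply: val_geMl.
by exists a, (b / u); rewrite scalerA divfK //; split=> //; apply: val_geMl.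
Qed.

Lemma suborder_orbits_card (G : set 'M[k]_2) e : conj_group G ->
  classified (opt_nilpotent v E) (conj_unit_rel v G) e -> suborder_orbits Y G #= `I_e.
Proof.
move=> [Gu G1 GM GV] [f [fR fe fs]].
(* [gen] picks a nilpotent generator of each suborder; the choice is unique only up to units, which
   [conj_unit_rel] absorbs. *)
have /choice [gen genP] : forall S, exists n, Y S -> opt_nilpotent v E n /\ S = nil_order n.
  move=> S; have [YS|] := pselect (Y S); last by exists 0.
  by have [n hn SE] := suborder_nil_order YS; exists n.
have orbE S S' : (exists2 g, G g & conj_by g @` S = S') <->
    [set conj_by g @` S | g in G] = [set conj_by g @` S' | g in G].
  have comp g h (T : set 'M[k]_2) : g \is a GRing.unit -> h \is a GRing.unit ->
      conj_by (g * h) @` T = conj_by g @` (conj_by h @` T).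
    by move=> gu hu; rewrite image_comp; apply: eq_imagel => n _; rewrite /= conj_byM.
  have comp1 (T : set 'M[k]_2) : conj_by 1 @` T = T.
    by rewrite -[RHS]image_id; apply: eq_imagel => n _; rewrite conj_by1.
  split=> [[g gG <-]|e0]; last first.
    have : [set conj_by g @` S' | g in G] S' by exists 1.
    by rewrite -e0 => -[g gG <-]; exists g.
  apply/seteqP; split=> _ [x xG <-].
    exists (x * g^-1); first by apply: GM => //; apply: GV.
    rewrite -comp ?mulrVK //; try exact: Gu.
    by apply: Gu; apply: GM => //; apply: GV.
  exists (x * g); first exact: GM.
  by rewrite comp //; apply: Gu.
have relE n n' : opt_nilpotent v E n -> opt_nilpotent v E n' ->
    (exists2 g, G g & conj_by g @` nil_order n = nil_order n') <-> conj_unit_rel v G n n'.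
  move=> [n0 nn _] [n'0 n'n' _].
  have aux g : G g -> conj_by g @` nil_order n = nil_order n' <->
      exists2 u, val_unit v u & conj_by g n = u *: n'.
    move=> gG; have gu := Gu _ gG; rewrite conj_nil_order //; apply: nil_order_eqP => //.
      apply/eqP => h0; move/eqP: n0; rewrite -[n](conj_byK _ gu) h0.
      by rewrite conj_by0.
    by rewrite -conj_by_mul // nn conj_by0.
  split=> [[g gG /(aux _ gG) [u hu hg]]|[u hu [g gG hg]]].
    by exists u => //; exists g.
  by exists g => //; apply/(aux _ gG); exists u.
have cl : classified Y (fun S S' => conj_unit_rel v G (gen S) (gen S')) e.
  exists (fun S => f (gen S)); split.
  - by move=> S S' /genP [h _] /genP [h' _]; apply: fR.
  - by move=> S /genP [h _]; apply: fe.
  - move=> i /fs [n hn <-]; have Yn := nil_order_suborder hn.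
    exists (nil_order n) => //; have [h e0] := genP _ Yn.
    apply/fR => //; apply/relE => //; exists 1 => //.
    by rewrite -e0 -[RHS]image_id; apply: eq_imagel => m _; rewrite conj_by1.
apply: classified_card cl => S S' YS YS'.
have [h e0] := genP _ YS; have [h' e0'] := genP _ YS'.
apply: (iff_trans (iff_sym (orbE _ _))).
by rewrite {1}e0 {1}e0'; apply: relE.
Qed.

End Embeddings.

(** * Eichler orders are conjugate to the standard one *)

Section Lattices.
Variables (k : fieldType) (v : k -> int).
Hypothesis hv : discrete_valuation v.
Variable pi : k.
Hypothesis hpi : uniformizer v pi.
Local Notation O := (val_ge v 0).
Local Notation M := (eichler0 v 0).

Lemma val_ge_family q (t : 'I_q -> k) : exists N : nat, forall i, val_ge v (- N%:Z) (t i).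
Proof.
exists (\max_i `|v (t i)|%N)%N => i; right.
have := leq_bigmax (F := fun i => `|v (t i)|%N) i; lia.
Qed.

(** Discreteness of the valuation. It supplies the generators of fractional ideals and the pivot of
    the Smith form. *)
Lemma val_min (P : k -> Prop) (N : int) :
  (forall x, P x -> val_ge v N x) -> (exists2 x, P x & x != 0) ->
  exists x, [/\ P x, x != 0 & forall y, P y -> val_ge v (v x) y].
Proof.
move=> PN [x0 Px0 x00].
pose Q n := `[< exists x, [/\ P x, x != 0 & v x = N + n%:Z] >].
have exQ : exists n, Q n.
  exists `|v x0 - N|%N; apply/asboolP; exists x0; split=> //.
  by have := PN _ Px0; rewrite val_geE //; lia.
case: (ex_minnP exQ) => n /asboolP [x [Px x0' vx]] nmin.
exists x; split=> // y Py; have [->|y0] := eqVneq y 0; first by left.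
right; have := PN _ Py; rewrite val_geE // => Ny.
have /nmin : Q `|v y - N|%N by apply/asboolP; exists y; split=> //; lia.
lia.
Qed.

Lemma conj_by_sum q (h : 'M[k]_2) (F : 'I_q -> 'M[k]_2) :
  conj_by h (\sum_i F i) = \sum_i conj_by h (F i).
Proof. by apply: (big_morph (conj_by h) (conj_byD h) (conj_by0 h)). Qed.

Lemma span_over_conj (C : set k) (S : set 'M[k]_2) h : h \is a GRing.unit ->
  span_over C (conj_by h @` S) = conj_by h @` span_over C S.
Proof.
move=> hu; apply/seteqP; split=> [m|_ [_ [q [a [t [aC tS ->]]]] <-]].
  move=> [q [a [t [aC tS ->]]]].
  exists (\sum_i a i *: conj_by h^-1 (t i)).
    exists q, a, (fun i => conj_by h^-1 (t i)); split=> // i.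
    by apply/conj_by_imageE.
  by rewrite conj_by_sum; apply: eq_bigr => i _; rewrite conj_byZ conj_byVK.
exists q, a, (fun i => conj_by h (t i)); split=> //.
  by move=> i; exists (t i).
by rewrite conj_by_sum; apply: eq_bigr => i _; rewrite conj_byZ.
Qed.

Lemma full_order_conj (R : set 'M[k]_2) h : h \is a GRing.unit ->
  full_order v R -> full_order v (conj_by h @` R).
Proof.
move=> hu [[R1 RM [q [s RE]]] Rf]; split; first split.
- by exists 1 => //; rewrite conj_by_unit.
- by move=> _ _ [m mR <-] [n nR <-]; exists (m * n); [apply: RM|rewrite conj_by_mul].
- exists q, (conj_by h \o s).
  by rewrite -(image_comp s (conj_by h)) span_over_conj // {1}RE.
- rewrite span_over_conj // Rf; apply/seteqP; split=> // m _.
  by apply/conj_by_imageE.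
Qed.

Lemma full_order_std : full_order v M.
Proof.
pose s (i : 'I_4) : 'M[k]_2 :=
  nth 0 [:: mx2 1 0 0 0; mx2 0 1 0 0; mx2 0 0 1 0; mx2 0 0 0 1] i.
have sE a b c d : mx2 a b c d = \sum_(i < 4) (nth 0 [:: a; b; c; d] i) *: s i.
  rewrite !big_ord_recl big_ord0 /s /= !mx2Z mx2_0 !mx2D.
  by rewrite !(mulr0, mulr1, addr0, add0r).
have O0 : O 0 by left.
have O1 : O 1 by apply: val_ge_1.
have sM i : M (s i).
  by case: i => -[|[|[|[|//]]]] hi; rewrite /s /= eichler0_mx2.
split; first split.
- exact: eichler0_1.
- exact: eichler0M.
- exists 4%N, s; apply/seteqP; split=> [m|_ [q [a [t [aO tS ->]]]]].
    rewrite [m]mx2_eta eichler0_mx2 => -[h1 h2 h3 h4]; rewrite sE.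
    exists 4%N, (fun i : 'I_4 => nth 0 [:: m 0 0; m 0 1; m 1 0; m 1 1] i), s.
    split=> //.
    by case=> -[|[|[|[|//]]]] hi.
  elim/big_ind: _ => [|x y xM yM|i _].
  + by rewrite mx2_0 eichler0_mx2.
  + by rewrite -[x]scale1r; apply: eichler0_lin.
  + have [j _ <-] := tS i; rewrite -[_ *: _]addr0; apply: eichler0_lin => //; first exact: aO.
    by rewrite mx2_0 eichler0_mx2.
- apply/seteqP; split=> // m _; rewrite [m]mx2_eta sE.
  by exists 4%N, (fun i : 'I_4 => nth 0 [:: m 0 0; m 0 1; m 1 0; m 1 1] i), s.
Qed.

Lemma span_over_rangeP q (s : 'I_q -> 'M[k]_2) m :
  span_over (integers v) (range s) m <->
  exists2 a : 'I_q -> k, forall i, O (a i) & m = \sum_i a i *: s i.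
Proof.
split=> [|[a aO ->]]; last by exists q, a, s; split=> // i; exists i.
move=> [q' [a [t [aO tS ->]]]].
elim/big_ind: _ => [|x y [a1 h1 ->] [a2 h2 ->]|i _].
- exists (fun=> 0); first by left.
  by rewrite big1 // => i _; rewrite scale0r.
- exists (fun i => a1 i + a2 i); first by move=> i; apply: val_geD.
  by rewrite -big_split; apply: eq_bigr => i _; rewrite scalerDl.
- have [j _ <-] := tS i; exists (fun j' => if j' == j then a i else 0).
    by move=> j'; case: ifP => _; [apply: aO|left].
  rewrite (bigD1 j) //= eqxx big1 ?addr0 // => j' /negPf ->.
  by rewrite scale0r.
Qed.

(* A full order stabilises a lattice, namely the module of the first columns of
   its elements; [g] is a triangular basis of that lattice. *)
Lemma full_order_stable (R : set 'M[k]_2) : full_order v R ->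
  exists2 g, g \is a GRing.unit & forall m, R m -> M (conj_by g^-1 m).
Proof.
move=> [[R1 RM [q [s RE]]] Rf].
have RP m : R m <-> exists2 a : 'I_q -> k, forall i, O (a i) & m = \sum_i a i *: s i.
  by rewrite {1}RE; apply: span_over_rangeP.
have sR i : R (s i).
  apply/RP; exists (fun j => if j == i then 1 else 0).
    by move=> j; case: ifP => _; [apply: val_ge_1|left].
  rewrite (bigD1 i) //= eqxx scale1r big1 ?addr0 // => j /negPf ->.
  by rewrite scale0r.
have Rlin a m n : O a -> R m -> R n -> R (a *: m + n).
  move=> aO /RP [b bO ->] /RP [c cO ->]; apply/RP.
  exists (fun i => a * b i + c i).
    by move=> i; apply: val_geD => //; apply: val_geMl.
  rewrite scaler_sumr -big_split; apply: eq_bigr => i _.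
  by rewrite scalerDl scalerA.
have R0 : R 0.
  rewrite -(subrr 1) -scaleN1r addrC; apply: Rlin => //.
  by rewrite (val_geN hv); apply: val_ge_1.
(* R spans M_2(k), and a power of pi clears the finitely many denominators. *)
have Rscale m : exists n : nat, R (pi ^+ n *: m).
  have : span_over setT R m by rewrite Rf.
  move=> [q' [a [t [_ tR ->]]]]; have [N aN] := val_ge_family a.
  exists N; rewrite scaler_sumr; elim/big_ind: _ => // [x y xR yR|i _].
    by rewrite -[x]scale1r; apply: Rlin => //; apply: val_ge_1.
  rewrite scalerA -[_ *: _]addr0; apply: Rlin => //.
  rewrite (val_geZ hv) ?(unifX_neq0 hpi) // (val_unifX hv hpi).
  by apply: val_geW (aN i) _; lia.
pose Lam x y := exists2 m, R m & x = m 0 0 /\ y = m 1 0.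
have Lam_lin a x y x' y' : O a -> Lam x y -> Lam x' y' -> Lam (a * x + x') (a * y + y').
  move=> aO [m mR [-> ->]] [n nR [-> ->]]; exists (a *: m + n); first exact: Rlin.
  by rewrite !mxE.
have LamR m x y : R m -> Lam x y -> Lam (m 0 0 * x + m 0 1 * y) (m 1 0 * x + m 1 1 * y).
  move=> mR [n nR [-> ->]]; exists (m * n); first exact: RM.
  by rewrite [m]mx2_eta [n]mx2_eta mx2M !mx2E.
have [N1 hN1] := val_ge_family (fun i => s i 0 0).
have [N2 hN2] := val_ge_family (fun i => s i 1 0).
have sum_ge (N : nat) (a t : 'I_q -> k) : (forall i, O (a i)) ->
    (forall i, val_ge v (- N%:Z) (t i)) -> val_ge v (- N%:Z) (\sum_i a i * t i).
  move=> aO tN; elim/big_ind: _ => [|x y|i _]; first by left.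
    exact: val_geD.
  exact: val_geMl.
have Lam1 x y : Lam x y -> val_ge v (- N1%:Z) x.
  move=> [m /RP [a aO ->] [-> _]]; rewrite summxE.
  under eq_bigr do rewrite mxE.
  exact: sum_ge.
have Lam2 x y : Lam x y -> val_ge v (- N2%:Z) y.
  move=> [m /RP [a aO ->] [_ ->]]; rewrite summxE.
  under eq_bigr do rewrite mxE.
  exact: sum_ge.
(* [al] generates the fractional ideal of first coordinates of [Lam], and [be] completes it to a
   vector of [Lam]. *)
have [al [[be albe] al0 almin]] : exists al, [/\ exists y, Lam al y, al != 0 &
    forall x, (exists y, Lam x y) -> val_ge v (v al) x].
  apply: (val_min (N := - N1%:Z)); first by move=> x [y]; apply: Lam1.
  have [n hn] := Rscale 1; exists (pi ^+ n); last exact: unifX_neq0 hpi n.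
  by exists 0; exists (pi ^+ n *: 1) => //; rewrite mx2_1 mx2Z !mx2E mulr1 mulr0.
(* [ga] generates the part of [Lam] with first coordinate 0, so that (al, be) and (0, ga) form a
   basis. *)
have [ga [Lga ga0 gamin]] : exists ga, [/\ Lam 0 ga, ga != 0 &
    forall y, Lam 0 y -> val_ge v (v ga) y].
  apply: (val_min (N := - N2%:Z)); first by move=> y; apply: Lam2.
  have [n hn] := Rscale (mx2 0 0 1 0); exists (pi ^+ n); last exact: unifX_neq0 hpi n.
  by exists (pi ^+ n *: mx2 0 0 1 0) => //; rewrite mx2Z !mx2E mulr1 mulr0.
have coord x y : Lam x y -> exists a b, [/\ O a, O b, x = al * a & y = be * a + ga * b].
  move=> Lxy; pose a := x / al.
  have aO : O a.
    rewrite /a mulrC (val_geZ hv) ?invr_eq0 // (valuationV hv) // opprK add0r.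
    by apply: almin; exists y.
  have Ly : Lam 0 (y - be * a).
    have -> : 0 = (- a) * al + x by rewrite mulNr /a divfK // addNr.
    rewrite (_ : y - be * a = (- a) * be + y); last by ring.
    by apply: Lam_lin => //; rewrite (val_geN hv).
  exists a, ((y - be * a) / ga); split=> //.
  - rewrite mulrC (val_geZ hv) ?invr_eq0 // (valuationV hv) // opprK add0r.
    exact: gamin.
  - by rewrite mulrC /a divfK.
  - by rewrite [ga * _]mulrC divfK // addrC subrK.
have gu : mx2 al 0 be ga \is a GRing.unit.
  by rewrite unitmx2 det_mx2 mul0r subr0 mulf_neq0.
exists (mx2 al 0 be ga) => // m mR.
(* The integral coordinates of the images under m of the two basis vectors are the columns of g^-1 m
   g. *)
have [a [b [aO bO e1 e2]]] := coord _ _ (LamR _ _ _ mR albe).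
have [a' [b' [a'O b'O e1' e2']]] := coord _ _ (LamR _ _ _ mR Lga).
have -> : conj_by (mx2 al 0 be ga)^-1 m = mx2 a a' b b'.
  have <- : conj_by (mx2 al 0 be ga) (mx2 a a' b b') = m; last by rewrite conj_byK.
  apply/conj_byP => //; rewrite {1}[m]mx2_eta !mx2M -e2 -e2' !mul0r !addr0 -e1 -e1'.
  by congr mx2; ring.
by rewrite eichler0_mx2.
Qed.

Lemma maximal_order_conj (R : set 'M[k]_2) : maximal_order v R ->
  exists2 g, g \is a GRing.unit & R = conj_by g @` M.
Proof.
move=> [Rf Rmax]; have [g gu gR] := full_order_stable Rf.
exists g => //; apply/esym/Rmax; first by apply: full_order_conj => //; apply: full_order_std.
by move=> m /gR hm; apply/conj_by_imageE.
Qed.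

Definition integral_GL (u : 'M[k]_2) : Prop := M u /\ val_unit v (\det u).

Lemma integral_GL_unit u : integral_GL u -> u \is a GRing.unit.
Proof. by move=> [_ [u0 _]]; rewrite unitmx2. Qed.

Lemma integral_GLM u w : integral_GL u -> integral_GL w -> integral_GL (u * w).
Proof.
move=> [uM ud] [wM wd]; split; first exact: eichler0M.
by rewrite detM; apply: val_unitM.
Qed.

Lemma integral_GL_conj u : integral_GL u -> conj_by u @` M = M.
Proof.
move=> [uM ud]; have : scalar_units M u.
  exists 1, u; rewrite oner_neq0 scale1r; split=> //.
  exact/unit_group0P.
by move=> /scalar_units0_sub_normalizer - /(_ hv) [].
Qed.

(** Smith form over O with the scalar a split off: conjugation does not see a, and only s survives,
    as the level. *)
Definition diagonalisable (h : 'M[k]_2) : Prop :=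
  exists u w a (s : nat),
    [/\ integral_GL u, integral_GL w, a != 0 & h = u * (a *: mx2 1 0 0 (pi ^+ s)) * w].

Lemma diagonalisableM u h w : integral_GL u -> integral_GL w -> diagonalisable h -> diagonalisable (u * h * w).
Proof.
move=> hu hw [u' [w' [a [s [hu' hw' a0 ->]]]]].
exists (u * u'), (w' * w), a, s; split=> //; try exact: integral_GLM.
by rewrite !mulrA.
Qed.

Lemma diagonalisable_pivot a b c d : a * d - b * c != 0 -> a != 0 ->
  val_ge v (v a) b -> val_ge v (v a) c -> val_ge v (v a) d ->
  diagonalisable (mx2 a b c d).
Proof.
move=> dt a0 hb hc hd.
have O0 : O 0 by left.
have O1 : O 1 by apply: val_ge_1.
have divO t : val_ge v (v a) t -> O (t / a).
  by move=> ht; rewrite mulrC (val_geZ hv) ?invr_eq0 // (valuationV hv) // opprK add0r.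
(* The Schur complement of the pivot a, divided by a; its unit part goes into the right factor. *)
pose e := (d - b * c / a) / a.
have eO : O e.
  by apply: (divO); apply: val_geB => //; rewrite -mulrA mulrC; apply: val_geMl => //; apply: divO.
have e0 : e != 0.
  rewrite (_ : e = (a * d - b * c) / (a * a)); last by rewrite /e; field.
  by rewrite mulf_neq0 ?invr_eq0 ?mulf_neq0.
have ve : v e = (`|v e|%N)%:Z by move: eO; rewrite val_geE //; lia.
exists (mx2 1 0 (c / a) 1), (mx2 1 (b / a) 0 (e / pi ^+ `|v e|%N)), a, `|v e|%N; split=> //.
- split; first by rewrite eichler0_mx2; split=> //; apply: divO.
  by rewrite det_mx2 mul0r subr0 mulr1; apply: val_unit1.
- split.
    rewrite eichler0_mx2; split=> //; first exact: divO.
    by rewrite (val_ge_div hv hpi) add0r; right; lia.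
  rewrite det_mx2 mulr0 subr0 mul1r; split; first by rewrite mulf_neq0 ?invr_eq0 ?(unifX_neq0 hpi).
  rewrite (valuationM hv) ?invr_eq0 ?(unifX_neq0 hpi) //.
  by rewrite (valuationV hv) ?(unifX_neq0 hpi) // (val_unifX hv hpi); lia.
- rewrite mx2Z !mx2M; have p0 := unifX_neq0 hpi `|v e|%N; move: p0.
  move: (pi ^+ _) => P p0; congr mx2; rewrite /e; field; by rewrite ?a0 ?p0.
Qed.

Lemma integral_GL_swap : integral_GL (mx2 0 1 1 0).
Proof.
have O1 : O 1 by apply: val_ge_1.
split; first by rewrite eichler0_mx2; split=> //; left.
rewrite det_mx2 mulr0 mulr1 sub0r; split; first by rewrite oppr_eq0 oner_neq0.
by rewrite (valuationN hv) (valuation1 hv).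
Qed.

(** Row and column swaps bring an entry of least valuation to the upper left corner, where it serves
    as pivot. *)
Lemma smith_form h : h \is a GRing.unit -> diagonalisable h.
Proof.
rewrite [h]mx2_eta; move: (h 0 0) (h 0 1) (h 1 0) (h 1 1) => a b c d.
rewrite unitmx2 det_mx2 => dt; clear h.
have swapK : mx2 0 1 1 0 * mx2 0 1 1 0 = 1 :> 'M[k]_2.
  by rewrite mx2M mx2_1 !(mul0r, mulr0, mul1r, mulr1, addr0, add0r).
have hs := integral_GL_swap; have h1 : integral_GL 1.
  by split; [exact: eichler0_1|rewrite det1; exact: val_unit1].
pose P x := x \in [:: a; b; c; d].
have [x [Px x0 xmin]] : exists x, [/\ P x, x != 0 & forall y, P y -> val_ge v (v x) y].
  have [N hN] := val_ge_family (fun i : 'I_4 => nth 0 [:: a; b; c; d] i).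
  apply: (val_min (N := - N%:Z)).
    move=> x /(nthP 0) [i il <-]; exact: (hN (Ordinal il)).
  case: (eqVneq a 0) => [a0|a0]; last by exists a => //; rewrite /P !inE eqxx.
  exists b; first by rewrite /P !inE eqxx orbT.
  by apply: contraNneq dt => b0; rewrite a0 b0 !mul0r subr0.
have ha : val_ge v (v x) a by apply: xmin; rewrite /P !inE eqxx.
have hb : val_ge v (v x) b by apply: xmin; rewrite /P !inE eqxx orbT.
have hc : val_ge v (v x) c by apply: xmin; rewrite /P !inE eqxx !orbT.
have hd : val_ge v (v x) d by apply: xmin; rewrite /P !inE eqxx !orbT.
move: Px; rewrite /P !inE => /or4P [] /eqP xE; rewrite {}xE in x0 ha hb hc hd {xmin}.
- exact: diagonalisable_pivot.
- have -> : mx2 a b c d = 1 * mx2 b a d c * mx2 0 1 1 0.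
    by rewrite mul1r mx2M; congr mx2; ring.
  apply: diagonalisableM => //; apply: diagonalisable_pivot => //.
  by rewrite -oppr_eq0 opprB.
- have -> : mx2 a b c d = mx2 0 1 1 0 * mx2 c d a b * 1.
    by rewrite mulr1 mx2M; congr mx2; ring.
  apply: diagonalisableM => //; apply: diagonalisable_pivot => //.
  by rewrite -oppr_eq0 opprB mulrC [c * b]mulrC.
- have -> : mx2 a b c d = mx2 0 1 1 0 * mx2 d c b a * mx2 0 1 1 0.
    by rewrite !mx2M; congr mx2; ring.
  apply: diagonalisableM => //; apply: diagonalisable_pivot => //.
  by rewrite mulrC [c * b]mulrC.
Qed.

(** Conjugation by diag(1, pi^s) divides the upper right entry by pi^s and multiplies the lower left
    one by it; intersecting with M leaves only the second effect. *)
Lemma eichler0_capE s : M `&` (conj_by (mx2 1 0 0 (pi ^+ s)) @` M) = eichler0 v s.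
Proof.
have p0 := unifX_neq0 hpi s.
have du : mx2 1 0 0 (pi ^+ s) \is a GRing.unit.
  by rewrite unitmx2 det_mx2 mul1r mulr0 subr0.
have O_unifM t : O (pi ^+ s * t) <-> val_ge v (- s%:Z) t.
  by rewrite (val_geZ hv) // (val_unifX hv hpi) sub0r.
have invE : (mx2 1 0 0 (pi ^+ s))^-1 = mx2 1 0 0 (pi ^+ s)^-1.
  apply: (mulrI du); rewrite divrr // mx2M mx2_1.
  by congr mx2; field.
have memE m : (conj_by (mx2 1 0 0 (pi ^+ s)) @` M) m <->
    [/\ O (m 0 0), O (m 0 1 * pi ^+ s), O (m 1 0 / pi ^+ s) & O (m 1 1)].
  rewrite conj_by_imageE // /conj_by invrK invE {1}[m]mx2_eta !mx2M eichler0_mx2.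
  rewrite !(mul0r, mulr0, mul1r, mulr1, addr0, add0r).
  by rewrite [_^-1 * m 1 0]mulrC [_ * m 1 1 * _]mulrAC mulVf // mul1r.
apply/seteqP; split=> m.
  move=> [[h1 h2 h3 h4] /memE [_ _ h _]]; split=> //.
  by move: h; rewrite (val_ge_div hv hpi) add0r.
move=> [h1 h2 h3 h4]; split.
  by split=> //; apply: val_geW h3 _.
apply/memE; split=> //.
  by apply: val_geMr => //; apply: val_geW (unifX_ge hv hpi s) _.
by rewrite (val_ge_div hv hpi) add0r.
Qed.

(** Annihilators are compared. pi^r kills O / pi^r O, hence the class of e21, so s <= r; pi^s kills
    M / E0, hence a preimage of 1, so r <= s. As f is linear only modulo pi^r O, each step carries a
    correction term. *)
Lemma quotient_level g s r : g \is a GRing.unit ->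
  quotient_isomorphic (integers v) (conj_by g @` M) (conj_by g @` eichler0 v s)
    (integers v : set k^o) (uniformizer_ideal v pi r) -> s = r.
Proof.
move=> gu [f [fO flin fE fsurj]].
have O0 : O 0 by left.
have O1 : O 1 by apply: val_ge_1.
have idE t : uniformizer_ideal v pi r t <-> val_ge v r%:Z t by apply: uniformizer_idealE.
have D0 : (conj_by g @` M) 0.
  by exists 0; rewrite ?conj_by0 // mx2_0 eichler0_mx2.
have E0 : (conj_by g @` eichler0 v s) 0.
  by exists 0; rewrite ?conj_by0 // mx2_0 eichler0_mx2; split=> //; left.
have f0 : val_ge v r%:Z (f 0) by apply/idE/(fE _ D0).
have fZ a x : O a -> (conj_by g @` M) x -> val_ge v r%:Z (f (a *: x) - a * f x).
  move=> aO xD; have /idE := flin a x 0 aO xD D0; rewrite addr0 => h.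
  have := val_geD hv h f0.
  by rewrite opprD addrA subrK.
have piO n : O (pi ^+ n) by apply: val_geW (unifX_ge hv hpi n) _.
have Ox (n : nat) t : O t -> val_ge v n%:Z (pi ^+ n * t).
  by move=> tO; apply: val_geMr => //; apply: unifX_ge.
apply/eqP; rewrite eqn_leq; apply/andP; split.
  pose x := conj_by g (mx2 0 0 1 0).
  have xD : (conj_by g @` M) x by exists (mx2 0 0 1 0) => //; rewrite eichler0_mx2.
  have h := fZ (pi ^+ r) x (piO r) xD.
  have : (conj_by g @` eichler0 v s) (pi ^+ r *: x).
    apply/fE; first by exists (pi ^+ r *: mx2 0 0 1 0); rewrite ?conj_byZ // mx2Z eichler0_mx2 !mulr0 mulr1.
    apply/idE; rewrite -[f _](subrK (pi ^+ r * f x)); apply: val_geD => //.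
    by apply: Ox; apply: fO.
  rewrite conj_by_imageE // conj_byZ conj_byK // mx2Z eichler0_mx2 mulr1 => -[_ _ + _].
  by rewrite val_geE ?(unifX_neq0 hpi) // (val_unifX hv hpi).
have [x xD /idE hx] := fsurj 1 O1.
have h := fZ (pi ^+ s) x (piO s) xD.
have : (conj_by g @` eichler0 v s) (pi ^+ s *: x).
  move: xD => [m [h1 h2 h3 h4] <-]; exists (pi ^+ s *: m); last by rewrite conj_byZ.
  rewrite [m]mx2_eta mx2Z eichler0_mx2; split; try exact: val_geMl.
  exact: Ox.
move=> /(fE _ _)/idE hfx.
have : val_ge v r%:Z (pi ^+ s).
  rewrite (_ : pi ^+ s = pi ^+ s * (1 - f x) + (f (pi ^+ s *: x) - (f (pi ^+ s *: x) - pi ^+ s * f x))); last by ring.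
  apply: val_geD => //; first exact: val_geMl.
  apply: val_geB => //; apply: hfx; move: xD => [m mM <-].
  exists (pi ^+ s *: m + 0); last by rewrite addr0 conj_byZ.
  by apply: eichler0_lin => //; rewrite mx2_0 eichler0_mx2.
by rewrite val_geE ?(unifX_neq0 hpi) // (val_unifX hv hpi).
Qed.

(** In the Smith form of g1^-1 g2 the outer factors lie in GL_2(O), which normalises M, and the
    scalar acts trivially. So g1 u conjugates M and its conjugate by diag(1, pi^s) to the two given
    maximal orders at once. *)
Lemma eichler_order_conj r (E : set 'M[k]_2) : eichler_order v pi r E ->
  exists2 g, g \is a GRing.unit & E = conj_by g @` eichler0 v r.
Proof.
move=> [D1 [D2 [/maximal_order_conj [g1 g1u ->] /maximal_order_conj [g2 g2u ->] -> hq _]]].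
have [|u [w [a [s [hu hw a0 e]]]]] := @smith_form (g1^-1 * g2).
  by rewrite unitrMr ?unitrV.
have uu := integral_GL_unit hu; have wu := integral_GL_unit hw.
set dg := mx2 1 0 0 (pi ^+ s) in e.
have dgu : dg \is a GRing.unit.
  by rewrite unitmx2 det_mx2 mul1r mulr0 subr0 (unifX_neq0 hpi).
have comp g h (T : set 'M[k]_2) : g \is a GRing.unit -> h \is a GRing.unit ->
    conj_by (g * h) @` T = conj_by g @` (conj_by h @` T).
  by move=> gu hu'; rewrite image_comp; apply: eq_imagel => n _; rewrite /= conj_byM.
have g2E : g2 = a *: (g1 * u * dg * w).
  by rewrite -[LHS](mulVKr g1u) e -!scalerAr -scalerAl -!scalerAr !mulrA.
have D1E : conj_by g1 @` M = conj_by (g1 * u) @` M.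
  by rewrite comp // (integral_GL_conj hu).
have g1uu : g1 * u \is a GRing.unit by rewrite unitrMr.
have D2E : conj_by g2 @` M = conj_by (g1 * u) @` (conj_by dg @` M).
  rewrite -comp // -[in RHS](integral_GL_conj hw) -comp //; last by rewrite unitrMr.
  rewrite g2E; apply: eq_imagel => n _; rewrite conj_by_scale //.
  by rewrite unitrMr // unitrMr.
have EE : (conj_by g1 @` M) `&` (conj_by g2 @` M) = conj_by (g1 * u) @` eichler0 v s.
  rewrite D1E D2E -(eichler0_capE s); apply/seteqP; split=> m.
    by move=> [/(conj_by_imageE _ _ g1uu) h /(conj_by_imageE _ _ g1uu) h']; apply/conj_by_imageE.
  by move=> [n [h h'] <-]; split; exists n.
exists (g1 * u) => //; rewrite EE.
suff -> : s = r by [].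
by apply: (quotient_level g1uu); rewrite -EE -D1E.
Qed.

End Lattices.

(** * The embedding numbers of an arbitrary Eichler order *)

Lemma scalar_units_unit (k : fieldType) (E : set 'M[k]_2) g :
  scalar_units E g -> g \is a GRing.unit.
Proof.
move=> [a [u [a0 [_ [u' [_ h1 h2]]] ->]]].
by rewrite scaler_unit ?unitfE //; apply/unitrP; exists u'.
Qed.

Theorem theorem1p2 (k : fieldType) (v : k -> int) (hk : local_field v)
    (pi : k) (hpi : uniformizer v pi)
    (p : nat) (hp : residue_field v #= `I_p)
    (r : nat) (E : set 'M[k]_2) (hE : eichler_order v pi r E)
    (L : algType k) (c : L) (hc : c <> 0) (hc2 : c ^+ 2 = 0)
    (hL : span_over setT (adjoin_integers v c) = setT) :
  let H := adjoin_integers v c in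
  let X := optimal_embeddings H E in
  let Y := optimal_suborders v H E in
  let Gamma1 := scalar_units E in
  let Gamma2 := order_normalizer E in
  exists e1 e2 e3 e4 : nat,
    [/\ embedding_orbits X Gamma1 #= `I_e1,
        embedding_orbits X Gamma2 #= `I_e2,
        suborder_orbits Y Gamma1 #= `I_e3
      & suborder_orbits Y Gamma2 #= `I_e4] /\
    [/\ e4 = (r.+2)./2,
        e3 = r.+1,
        (r = 0%N -> e1 = 1%N) /\
        (r <> 0%N -> e1 = (p ^ (r./2) + p ^ (r.-1)./2)%N),
        ~~ odd r /\ uniformizer_ideal v pi (r./2) 2%:R -> e2 = (p ^ (r./2))%N
      & ~ (~~ odd r /\ uniformizer_ideal v pi (r./2) 2%:R) -> e1 = e2.*2].
Proof.
move=> H X Y Gamma1 Gamma2.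
have hv : discrete_valuation v by case: hk.
have c0 : c != 0 by apply/eqP.
have cc : c * c = 0 by rewrite -expr2.
have [h hu EE] := eichler_order_conj hv hpi hE.
have hgood0 : good_order v (eichler0 v r).
  split; [exact: eichler0_1|exact: eichler0_lin|exact: eichler0M|exact: eichler0_det].
have hgood : good_order v E by rewrite EE; apply: good_order_conj.
have hG1 : conj_group Gamma1 by case: hgood => ? _ ? _; apply: scalar_units_group.
have hG2 : conj_group Gamma2 by apply: order_normalizer_group.
have tr1 e := classified_conj v (eichler0 v r) e hu (@scalar_units_unit k)
  (fun E1 h1 g h1u => @scalar_units_conj k E1 h1 h1u g).
have tr2 e := classified_conj v (eichler0 v r) e hu
  (fun E1 g (hg : order_normalizer E1 g) => proj1 hg)
  (fun E1 h1 g h1u => @order_normalizer_conj k E1 h1 h1u g).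
have emb G e : conj_group G -> classified (opt_nilpotent v E) (conj_rel G) e ->
    embedding_orbits X G #= `I_e by apply: embedding_orbits_card.
have sub G e : conj_group G -> classified (opt_nilpotent v E) (conj_unit_rel v G) e ->
    suborder_orbits Y G #= `I_e by apply: suborder_orbits_card.
rewrite -EE in tr1 tr2.
have ideal2 := uniformizer_idealE hv hpi r./2 2%:R.
(* At level 0 all four numbers are 1, and 2 = 0 modulo pi^0 holds trivially, so e2 = p^0 falls under
   the even case. *)
have [r0|r0] := eqVneq r 0%N.
  have two : val_ge v r./2%:Z 2%:R.
    by rewrite r0 mulr2n; apply: val_geD => //; apply: val_ge_1.
  have sub12 n n' : conj_rel (scalar_units (eichler0 v r)) n n' ->
      conj_rel (order_normalizer (eichler0 v r)) n n'.
    by move=> [g gG gn]; exists g => //; apply: scalar_units0_sub_normalizer.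
  have unit1 (G : set 'M[k]_2) n n' : conj_rel G n n' -> conj_unit_rel v G n n'.
    by exists 1; [exact: val_unit1|rewrite scale1r].
  exists 1%N, 1%N, 1%N, 1%N; split; last first.
    split; [by rewrite r0|by rewrite r0|by split|by rewrite r0|].
    by case; split; [rewrite r0|apply/ideal2].
  have cl := classified_level0 hv hpi r0.
  split.
  - by apply: emb => //; apply: (proj1 (tr1 1%N)); apply: cl.
  - by apply: emb => //; apply: (proj1 (tr2 1%N)); apply: cl.
  - by apply: sub => //; apply: (proj2 (tr1 1%N)); apply: cl => n n'; apply: unit1.
  - apply: sub => //; apply: (proj2 (tr2 1%N)); apply: cl => n n' /sub12.
    exact: unit1.
have r_gt0 : (0 < r)%N by lia.
have e1 := emb _ _ hG1 (proj1 (tr1 _) (classified_emb1 hv hpi hp r_gt0)).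
have e3 := sub _ _ hG1 (proj2 (tr1 _) (classified_sub1 hv hpi r_gt0)).
have e4 := sub _ _ hG2 (proj2 (tr2 _) (classified_sub2 hv hpi r_gt0)).
have [[rodd h2]|hn] := pselect (~~ odd r /\ val_ge v r./2%:Z 2%:R).
  have e2 := emb _ _ hG2 (proj1 (tr2 _) (classified_emb2_even hv hpi hp r_gt0 rodd h2)).
  exists (p ^ r./2 + p ^ r.-1./2)%N, (p ^ r./2)%N, r.+1, (r.+2)./2; split=> //.
  split=> //; first by split=> // r0'; rewrite r0' in r0.
  by case; split=> //; apply/ideal2.
have [e ee /(proj1 (tr2 _)) /(emb _ _ hG2) e2] := classified_emb2_free hv hpi hp r_gt0 hn.
exists (p ^ r./2 + p ^ r.-1./2)%N, e, r.+1, (r.+2)./2; split=> //.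
split=> //; first by split=> // r0'; rewrite r0' in r0.
by move=> [rodd /ideal2 h2]; case: hn.
Qed.
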